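(* Let $N\in\mathbb{N}$, $N\ge1$, $J=\frac{(N+1)(N+2)}{2}$, let $\{P_j=(\rho_j,\theta_j)\}_{j=1}^{J}$ be a set of regular points, and let $\phi_{N,j}(r,\phi)=K_N(r,\phi;\rho_j,\theta_j)$, $j=1,\dots,J$, be the corresponding scaling functions. Then: (i) $\langle\phi_{N,i},\phi_{N,j}\rangle=\phi_{N,i}(P_j)$ for all $i,j\in\{1,\dots,J\}$. (ii) The scaling function $\phi_{N,j}$ is localized around $P_j$, in the sense that $$\left\|\frac{\phi_{N,j}(r,\phi)}{\phi_{N,j}(P_j)}\right\|=\min\{\|p\|: p\in V_N,\ p(P_j)=1\}.$$ (iii) The set $\{\phi_{N,j}\}_{j=1}^{J}$ is a basis of $V_N$. (iv) The dual of $\{\phi_{N,j}\}_{j=1}^{J}$ is given by the fundamental Lagrange interpolating polynomials $\{\ell_j\}_{j=1}^{J}$ with respect to the points $\{P_j\}_{j=1}^{J}$, i.e. $\langle\phi_{N,j},\ell_k\rangle=\delta_{jk}$ for all $j,k$. (v) The scaling function $\phi_{N,j}$ is orthogonal to $V_{N-1}$ with respect to the modified inner product $\langle\,\cdot\,,\,\cdot(\cdot-P_j)\rangle$, i.e. writing $(x_j,y_j)$ for the Cartesian coordinates of $P_j$, for every $q\in V_{N-1}$, $$\langle\phi_{N,j},\,q\cdot(x-x_j)\rangle=0\quad\text{and}\quad\langle\phi_{N,j},\,q\cdot(y-y_j)\rangle=0.$$ (vi) The scaling function satisfies the Christoffel–Darboux formula: for $r\ne\rho_j$, $$\phi_{N,j}(r,\phi)=\sum_{\substack{m=-N\\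 N-m\ \mathrm{even}}}^{N}b_N^m\,\frac{Z_{N+2}^m(r,\phi)\overline{Z_N^m(P_j)}-Z_N^m(r,\phi)\overline{Z_{N+2}^m(P_j)}}{r^2-\rho_j^2}+\sum_{\substack{m=-(N-1)\\ N-1-m\ \mathrm{even}}}^{N-1}b_{N-1}^m\,\frac{Z_{N+1}^m(r,\phi)\overline{Z_{N-1}^m(P_j)}-Z_{N-1}^m(r,\phi)\overline{Z_{N+1}^m(P_j)}}{r^2-\rho_j^2},$$ where $b_n^m=\frac{(n+2)^2-m^2}{4(n+2)}\cdot\frac{1}{\sqrt{(n+1)(n+3)}}$.
   Context: Points of the closed unit disk $B(0,1)=\{(x,y)\in\mathbb{R}^2: x^2+y^2\le 1\}$ are written in polar coordinates $(r,\phi)$, $0\le r\le 1$, $0\le\phi<2\pi$. The inner product on $L^2(B(0,1))$ is $\langle f,g\rangle=\int_0^1\int_0^{2\pi}f(r,\phi)\overline{g(r,\phi)}\,r\,d\phi\,dr$, with norm $\|\cdot\|$. For $N\in\mathbb{N}_0$, $V_N$ is the complex vector space of all polynomials in two variables $x,y$ of total degree at most $N$, regarded as functions on $B(0,1)$; its dimension is $\frac{(N+1)(N+2)}{2}$. Zernike polynomials: for $n\in\mathbb{N}_0$ and $m\in\mathbb{Z}$ with $|m|\le n$ and $n-m$ even, $$Z_n^m(r,\phi)=\sqrt{\tfrac{n+1}{\pi}}\;R_n^{|m|}(r)\,e^{im\phi},\qquad R_n^{|m|}(r)=\sum_{s=0}^{(n-|m|)/2}\frac{(-1)^s(n-s)!}{s!\,\big(\frac{n+|m|}{2}-s\big)!\,\big(\frac{n-|m|}{2}-s\big)!}\,r^{n-2s}.$$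 Kernel polynomial with parameter $(\rho,\theta)$: $$K_N(r,\phi;\rho,\theta)=\sum_{n=0}^{N}\ \sum_{\substack{m=-n\\ n-m\ \mathrm{even}}}^{n}\overline{Z_n^m(\rho,\theta)}\,Z_n^m(r,\phi).$$ Regular points: given $N$, set $k=\lfloor N/2\rfloor+1$. Take radii $1>\lambda_1>\cdots>\lambda_k\ge 0$ given by $\lambda_i=1.1565\,\zeta_i-0.76535\,\zeta_i^2+0.60517\,\zeta_i^3$, where $\zeta_i=\cos\frac{(2i-1)\pi}{2(N+1)}$, $1\le i\le k$. On the circle of radius $\lambda_i$ centered at the origin choose $n_i=2N+5-4i$ equally spaced points, $1\le i\le k$ (if $\lambda_k=0$, which happens for $N$ even, then $n_k=1$ and the point is the origin). This gives in total $J$ points, and such a set is called a set of regular points. Fundamental Lagrange polynomials: polynomial interpolation from $V_N$ at a set of regular points is uniquely solvable, and $\ell_i\in V_N$ is the polynomial characterized by $\ell_i(P_j)=\delta_{ij}$. Explicitly, enumerating the Zernike polynomials of degree at most $N$ by the single index $\frac{n(n+2)+m}{2}$ as $Z_0,\dots,Z_{J-1}$ and putting $A_N=[Z_{j-1}(P_i)]_{i,j=1}^{J}$, one has $\ell_i(x,y)=\det(A_N^{(i)}(x,y))/\det A_N$, where $A_N^{(i)}(x,y)$ is $A_N$ with its $i$th row replaced by $(Z_{j-1}(x,y))_{j=1}^{J}$. *)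

(* Defs.v *)
From HB Require Import structures.
From mathcomp Require Import all_boot all_order all_algebra.
From mathcomp Require Import complex.
From mathcomp Require Import all_classical all_reals all_analysis.

Set Implicit Arguments.
Unset Strict Implicit.
Unset Printing Implicit Defensive.

Import Order.TTheory GRing.Theory Num.Theory.
Import numFieldNormedType.Exports.

Local Open Scope classical_set_scope.
Local Open Scope ring_scope.
Local Open Scope complex_scope.

(* A function on the closed unit disk is represented by the function
   (r, phi) |-> f r phi of the polar coordinates; only its values on polar
   coordinates satisfying [polar] are meaningful. *)
Definition polar {R : realType} (r phi : R) : Prop :=
  0 <= r <= 1 /\ 0 <= phi < 2 * pi.

Definition cart {R : realType} (r phi : R) : R * R :=
  (r * cos phi, r * sin phi).

Definition expi {R : realType} (t : R) : R[i] := cos t +i* sin t.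

Definition Cintegral {R : realType} (a b : R) (f : R -> R[i]) : R[i] :=
  (\int[lebesgue_measure]_(t in `[a, b]) complex.Re (f t))%R
  +i* (\int[lebesgue_measure]_(t in `[a, b]) complex.Im (f t))%R.

Definition inner {R : realType} (f g : R -> R -> R[i]) : R[i] :=
  Cintegral 0 1 (fun r =>
    Cintegral 0 (2 * pi) (fun phi => f r phi * (g r phi)^* * r%:C)).

Definition norm2 {R : realType} (f : R -> R -> R[i]) : R :=
  Num.sqrt (complex.Re (inner f f)).

(* The space V_N of polynomials in x = r cos phi, y = r sin phi with complex
   coefficients and total degree at most N, as functions on the disk. *)
Definition V {R : realType} (N : nat) : set (R -> R -> R[i]) :=
  [set f | exists c : nat -> nat -> R[i], forall r phi, polar r phi ->
     f r phi = \sum_(a < N.+1) \sum_(b < N.+1 | (a + b <= N)%N)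
       c a b * (r * cos phi)%:C ^+ a * (r * sin phi)%:C ^+ b].

Definition dimV (N : nat) : nat := (N.+1 * N.+2) %/ 2.

Definition is_basis {R : realType} (W : set (R -> R -> R[i])) (J : nat)
    (f : 'I_J -> R -> R -> R[i]) : Prop :=
  [/\ forall j, W (f j),
      forall c : 'I_J -> R[i],
        (forall r phi, polar r phi -> \sum_(j < J) c j * f j r phi = 0) ->
        forall j, c j = 0
    & forall g, W g -> exists c : 'I_J -> R[i],
        forall r phi, polar r phi -> g r phi = \sum_(j < J) c j * f j r phi].

Definition is_minimum {R : realType} (E : set R) (x : R) : Prop :=
  E x /\ lbound E x.

(* The radial polynomial R_n^k, for k <= n with n - k even. *)
Definition radial {R : realType} (n k : nat) (r : R) : R :=
  \sum_(s < ((n - k) %/ 2).+1)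
    (-1) ^+ s * (n - s)`!%:R
    / (s`! * ((n + k) %/ 2 - s)`! * ((n - k) %/ 2 - s)`!)%:R
    * r ^+ (n - 2 * s).

Definition zernike {R : realType} (n : nat) (m : int) (r phi : R) : R[i] :=
  (Num.sqrt (n.+1%:R / pi) * radial n `|m|%N r)%:C * expi (m%:~R * phi).

(* For t = 0, ..., n the integer [az n t] runs increasingly through the m with
   |m| <= n and n - m even. *)
Definition az (n t : nat) : int := (2 * t)%:Z - n%:Z.

Definition kernel_poly {R : realType} (N : nat) (rho theta r phi : R) : R[i] :=
  \sum_(n < N.+1) \sum_(t < n.+1)
    (zernike n (az n t) rho theta)^* * zernike n (az n t) r phi.

Definition zeta {R : realType} (N i : nat) : R :=
  cos ((2 * i%:R - 1) * pi / (2 * N.+1%:R)).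

(* The coefficients are 1.1565, 0.76535 and 0.60517, split so that no numeral
   becomes a large unary natural number. *)
Definition lambda {R : realType} (N i : nat) : R :=
  (115 * 10 ^+ 2 + 65) / 10 ^+ 4 * zeta N i
  - (765 * 10 ^+ 2 + 35) / 10 ^+ 5 * zeta N i ^+ 2
  + (605 * 10 ^+ 2 + 17) / 10 ^+ 5 * zeta N i ^+ 3.

(* The polar coordinates (rho j, theta j) enumerate, without repetition and in
   arbitrary order, the union over 1 <= i <= N/2 + 1 of 2N + 5 - 4i equally
   spaced points of the circle of radius lambda N i; the position alpha i of
   the first point on each circle is free. *)
Definition regular_points {R : realType} (N : nat)
    (rho theta : 'I_(dimV N) -> R) : Prop :=
  [/\ forall j, polar (rho j) (theta j),
      injective (fun j => cart (rho j) (theta j))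
    & exists alpha : nat -> R,
        range (fun j => cart (rho j) (theta j)) =
        [set p | exists i t : nat,
           [/\ (1 <= i <= (N %/ 2).+1)%N, (t < 2 * N + 5 - 4 * i)%N
             & p = cart (lambda N i)
                     (alpha i + 2 * pi * t%:R / (2 * N + 5 - 4 * i)%:R)]]].

Definition scaling {R : realType} (N : nat) (rho theta : 'I_(dimV N) -> R)
    (j : 'I_(dimV N)) : R -> R -> R[i] := kernel_poly N (rho j) (theta j).

(* The pairs (n, m) of degree n <= N, listed by increasing value of the single
   index (n (n + 2) + m) / 2, which for m = az n t equals n (n + 1) / 2 + t. *)
Definition zernike_modes (N : nat) : seq (nat * int) :=
  [seq (n, az n t) | n <- iota 0 N.+1, t <- iota 0 n.+1].

Definition zernike1 {R : realType} (N s : nat) : R -> R -> R[i] :=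
  let nm := nth (0%N, 0) (zernike_modes N) s in zernike nm.1 nm.2.

Definition zernike_mx {R : realType} (N : nat) (rho theta : 'I_(dimV N) -> R) :
    'M[R[i]]_(dimV N) :=
  \matrix_(i, j) zernike1 N j (rho i) (theta i).

Definition lagrange_poly {R : realType} (N : nat) (rho theta : 'I_(dimV N) -> R)
    (i : 'I_(dimV N)) (r phi : R) : R[i] :=
  \det (\matrix_(k, j) if k == i then zernike1 N j r phi
                       else zernike_mx rho theta k j)
  / \det (zernike_mx rho theta).

(* The property characterizing the fundamental Lagrange polynomials. *)
Definition is_fundamental {R : realType} (N : nat)
    (rho theta : 'I_(dimV N) -> R)
    (ell : 'I_(dimV N) -> R -> R -> R[i]) : Prop :=
  forall k, V N (ell k) /\ forall j, ell k (rho j) (theta j) = (k == j)%:R.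

Definition bcoef {R : realType} (n : nat) (m : int) : R :=
  (n.+2%:R ^+ 2 - m%:~R ^+ 2) / (4 * n.+2%:R)
  * (1 / Num.sqrt (n.+1%:R * n.+3%:R)).

(* The summand of the Christoffel-Darboux formula, without its denominator. *)
Definition cd_term {R : realType} (n : nat) (m : int) (rho theta r phi : R) :
    R[i] :=
  (bcoef n m)%:C *
  (zernike n.+2 m r phi * (zernike n m rho theta)^*
   - zernike n m r phi * (zernike n.+2 m rho theta)^*).

(* Main.v *)
Require Import Defs.
From HB Require Import structures.
From mathcomp Require Import all_boot all_order all_algebra.
From mathcomp Require Import complex.
From mathcomp Require Import all_classical all_reals all_analysis.
From mathcomp Require Import ring lra zify.
Set Implicit Arguments.
Unset Strict Implicit.
Unset Printing Implicit Defensive.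
Import Order.TTheory GRing.Theory Num.Theory.
Import numFieldNormedType.Exports.
Local Open Scope classical_set_scope.
Local Open Scope ring_scope.
Local Open Scope complex_scope.

(* Everything is expressed in the complex coordinate z = r e^{i phi}.  For
   n = p + q and m = p - q the Zernike polynomial Z_n^m is, up to normalisation,
   the disk polynomial sum_s (-1)^s 'C(q, s) 'C(p + q - s, q) z^(p-s) zbar^(q-s).
   Orthonormality reduces, by a Rodrigues formula for the radial part and
   repeated integration by parts, to a Beta integral.  By triangularity, the
   Zernike polynomials of degree at most N span V_N, so that K_N is the reproducing
   kernel of V_N; this gives (i), (v) and, by completing a square, (ii).
   Unisolvence at the regular points: a polynomial of V_N vanishing at the
   2N + 1 points of the outermost circle vanishes on that circle, since it is there
   a trigonometric polynomial of degree N.  The coefficient of e^{imphi} is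
   r^|m| h_m(r^2) with deg h_m <= (N - |m|) / 2, so that zeros on l circles kill
   all frequencies above N - 2l, and the 2(N - 2l) + 1 points of the next circle
   suffice again.  Hence the collocation matrix is invertible, which gives (iii)
   and (iv).  Finally (vi) telescopes from the three-term recurrence for
   |z|^2 Z_n^m. *)

(** * The complex exponential and complex-valued integrals *)

Section ComplexExponential.
Variable R : realType.
Implicit Types s t r phi : R.

Lemma expiD s t : expi (s + t) = expi s * expi t.
Proof. by rewrite /expi cosD sinD; congr (_ +i* _); rewrite addrC mulrC. Qed.

Lemma conj_complexE (x y : R) : Num.conj (x +i* y) = x -i* y.
Proof. by []. Qed.

Lemma conj_realC (x : R) : Num.conj x%:C = x%:C.
Proof. by rewrite conj_complexE oppr0. Qed.

Lemma expiN t : expi (- t) = Num.conj (expi t).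
Proof. by rewrite /expi cosN sinN. Qed.

Lemma expi0 : expi 0 = 1 :> R[i].
Proof. by rewrite /expi cos0 sin0. Qed.

Lemma expi2pi : expi (2 * pi) = 1 :> R[i].
Proof. by rewrite /expi mulrC mulr_natr cos2pi sin2pi. Qed.

Lemma expiMconj t : expi t * Num.conj (expi t) = 1.
Proof. by rewrite -expiN -expiD subrr expi0. Qed.

Lemma expi_neq0 t : expi t != 0.
Proof.
by apply/eqP => e0; have := expiMconj t; rewrite e0 mul0r => /esym/eqP; rewrite oner_eq0.
Qed.

Lemma expiMn (n : nat) t : expi (n%:R * t) = expi t ^+ n.
Proof.
elim: n => [|n IH]; first by rewrite mul0r expi0.
by rewrite -natr1 mulrDl mul1r expiD IH exprSr.
Qed.

Lemma expiMz (m n : nat) t :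
  expi ((m%:Z - n%:Z)%:~R * t) = expi t ^+ m * Num.conj (expi t) ^+ n.
Proof. by rewrite rmorphB mulrBl expiD expiN !expiMn rmorphXn. Qed.

Definition zc r phi : R[i] := r%:C * expi phi.

Lemma zcM_conj r phi : zc r phi * Num.conj (zc r phi) = (r ^+ 2)%:C.
Proof.
by rewrite /zc rmorphM /= conj_realC mulrACA expiMconj mulr1 expr2 rmorphM.
Qed.

Lemma zc_monomialE (a b : nat) r phi :
  zc r phi ^+ a * Num.conj (zc r phi) ^+ b
  = (r ^+ (a + b))%:C * expi ((a%:Z - b%:Z)%:~R * phi).
Proof.
by rewrite /zc rmorphM /= conj_realC !exprMn expiMz mulrACA -exprD rmorphXn.
Qed.

Lemma zc_re_im r phi : zc r phi = (r * cos phi) +i* (r * sin phi).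
Proof. by rewrite /zc /expi; simpc. Qed.

End ComplexExponential.

Section ComplexIntegral.
Variable R : realType.
Notation mu := (@lebesgue_measure R).
Implicit Types (f g : R -> R[i]) (a b : R).

Definition ccontinuous f :=
  continuous (fun x => complex.Re (f x)) /\ continuous (fun x => complex.Im (f x)).

Lemma ReD (x y : R[i]) : complex.Re (x + y) = complex.Re x + complex.Re y.
Proof. by case: x; case: y. Qed.
Lemma ImD (x y : R[i]) : complex.Im (x + y) = complex.Im x + complex.Im y.
Proof. by case: x; case: y. Qed.
Lemma ReM (x y : R[i]) : complex.Re (x * y)
  = complex.Re x * complex.Re y - complex.Im x * complex.Im y.
Proof. by case: x; case: y. Qed.
Lemma ImM (x y : R[i]) : complex.Im (x * y)
  = complex.Re x * complex.Im y + complex.Im x * complex.Re y.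
Proof. by case: x; case: y. Qed.

Lemma ccontinuous_cst c : ccontinuous (fun=> c).
Proof. by split=> x; exact: cvg_cst. Qed.

Lemma ccontinuous_real (f : R -> R) : continuous f -> ccontinuous (fun x => (f x)%:C).
Proof. by move=> cf; split=> //= x; exact: cvg_cst. Qed.

Lemma ccontinuousD f g : ccontinuous f -> ccontinuous g ->
  ccontinuous (fun x => f x + g x).
Proof.
move=> [rf imf] [rg img]; split.
- by under eq_fun do rewrite ReD; move=> x; apply: cvgD; [exact: rf|exact: rg].
- by under eq_fun do rewrite ImD; move=> x; apply: cvgD; [exact: imf|exact: img].
Qed.

Lemma ccontinuousM f g : ccontinuous f -> ccontinuous g ->
  ccontinuous (fun x => f x * g x).
Proof.
move=> [rf imf] [rg img]; split.
- under eq_fun do rewrite ReM; move=> x; apply: cvgB; apply: cvgM.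
  exact: rf. exact: rg. exact: imf. exact: img.
- under eq_fun do rewrite ImM; move=> x; apply: cvgD; apply: cvgM.
  exact: rf. exact: img. exact: imf. exact: rg.
Qed.

Lemma ccontinuous_sum (I : Type) (s : seq I) (F : I -> R -> R[i]) :
  (forall i, ccontinuous (F i)) -> ccontinuous (fun x => \sum_(i <- s) F i x).
Proof.
move=> cF; elim: s => [|i s IH].
  by under eq_fun do rewrite big_nil; exact: ccontinuous_cst.
by under eq_fun do rewrite big_cons; exact: ccontinuousD.
Qed.

Lemma ccontinuous_expi (c : R) : ccontinuous (fun x => expi (c * x)).
Proof.
have cc : continuous (fun x : R => c * x) by move=> x; apply: cvgM; [exact: cvg_cst|exact: cvg_id].
split=> x /=.
- apply: (@continuous_comp _ _ _ (fun x : R => c * x) cos x); first exact: cc.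
  exact: continuous_cos.
- apply: (@continuous_comp _ _ _ (fun x : R => c * x) sin x); first exact: cc.
  exact: continuous_sin.
Qed.

Lemma continuous_integrable (f : R -> R) a b : continuous f ->
  mu.-integrable `[a, b] (EFin \o f).
Proof.
move=> cf; apply: continuous_compact_integrable; first exact: segment_compact.
exact: continuous_subspaceT.
Qed.

Lemma eq_Cintegral a b f g : {in `[a, b], f =1 g} -> Cintegral a b f = Cintegral a b g.
Proof.
move=> fg; rewrite /Cintegral.
by congr (_ +i* _); apply: eq_Rintegral => x; rewrite inE => xab; rewrite fg.
Qed.

Lemma Rintegral_bndco (f : R -> R) a b :
  mu.-integrable `[a, b[ (EFin \o f) ->
  (\int[mu]_(x in `[a, b]) f x)%R = (\int[mu]_(x in `[a, b[) f x)%R.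
Proof. by move=> h; rewrite Rintegral_itv_bndo_bndc. Qed.

(** Polar angles satisfy phi < 2 pi, so functions on the disk are only controlled on the half-open
    interval. The endpoint is a null set, and integrability of [f] there is inherited from that of
    [g]. *)
Lemma eq_Cintegral_co a b f g : ccontinuous g -> {in `[a, b[, f =1 g} ->
  Cintegral a b f = Cintegral a b g.
Proof.
move=> [rg img] fg; rewrite /Cintegral.
have key (p q : R -> R) : continuous q -> {in `[a, b[, p =1 q} ->
    (\int[mu]_(x in `[a, b]) p x)%R = (\int[mu]_(x in `[a, b]) q x)%R.
  move=> cq pq.
  have iq : mu.-integrable `[a, b[ (EFin \o q).
    apply: (@integrableS _ _ _ mu `[a, b]) => //.
      by apply: subset_itvl; rewrite bnd_simp.
    exact: continuous_integrable.
  have ip : mu.-integrable `[a, b[ (EFin \o p).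
    apply: eq_integrable iq => // x; rewrite inE => xab /=.
    by rewrite pq.
  rewrite !Rintegral_bndco //; apply: eq_Rintegral => x; rewrite inE => xab.
  exact: pq.
by congr (_ +i* _); apply: key => // x xab; rewrite fg.
Qed.

Lemma CintegralD a b f g : ccontinuous f -> ccontinuous g ->
  Cintegral a b (fun x => f x + g x) = Cintegral a b f + Cintegral a b g.
Proof.
move=> [rf imf] [rg img]; rewrite /Cintegral; simpc; congr (_ +i* _).
- under eq_Rintegral do rewrite ReD.
  by rewrite RintegralD //; exact: continuous_integrable.
- under eq_Rintegral do rewrite ImD.
  by rewrite RintegralD //; exact: continuous_integrable.
Qed.

Lemma CintegralZ a b c f : ccontinuous f ->
  Cintegral a b (fun x => c * f x) = c * Cintegral a b f.
Proof.
move=> [rf imf]; rewrite /Cintegral; case: c => c d; simpc; congr (_ +i* _).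
- under eq_Rintegral do rewrite ReM /=.
  rewrite RintegralB // ?RintegralZl //; try exact: continuous_integrable.
  + by apply: continuous_integrable => x; apply: cvgM; [exact: cvg_cst|exact: rf].
  + by apply: continuous_integrable => x; apply: cvgM; [exact: cvg_cst|exact: imf].
- under eq_Rintegral do rewrite ImM /=.
  rewrite RintegralD // ?RintegralZl //; try exact: continuous_integrable.
  + by apply: continuous_integrable => x; apply: cvgM; [exact: cvg_cst|exact: imf].
  + by apply: continuous_integrable => x; apply: cvgM; [exact: cvg_cst|exact: rf].
Qed.

Lemma Cintegral_sum (I : Type) (s : seq I) a b (c : I -> R[i]) (F : I -> R -> R[i]) :
  (forall i, ccontinuous (F i)) ->
  Cintegral a b (fun x => \sum_(i <- s) c i * F i x)
  = \sum_(i <- s) c i * Cintegral a b (F i).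
Proof.
move=> cF; elim: s => [|i s IH].
  rewrite big_nil /Cintegral; under eq_Rintegral do rewrite big_nil /=.
  under [X in _ +i* X]eq_Rintegral do rewrite big_nil /=.
  by rewrite !Rintegral_cst //= mul0r.
have -> : (fun x => \sum_(j <- i :: s) c j * F j x)
    = (fun x => c i * F i x + \sum_(j <- s) c j * F j x).
  by apply/funext => x; rewrite big_cons.
have cM j : ccontinuous (fun x => c j * F j x).
  by apply: ccontinuousM => //; exact: ccontinuous_cst.
by rewrite CintegralD ?CintegralZ ?big_cons ?IH //; exact: ccontinuous_sum.
Qed.

Lemma Rintegral_FTC (f F : R -> R) a b : a < b -> continuous f ->
  (forall x : R, is_derive x 1 F (f x)) ->
  (\int[mu]_(x in `[a, b]) f x)%R = F b - F a.
Proof.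
move=> ab cf dF.
have cF x : {for x, continuous F}.
  by apply: differentiable_continuous; apply/derivable1_diffP; case: (dF x).
rewrite /Rintegral (@continuous_FTC2 _ f F) //.
- exact: continuous_subspaceT.
- split.
  + by move=> x _; case: (dF x).
  + by apply: cvg_at_right_filter; exact: cF.
  + by apply: cvg_at_left_filter; exact: cF.
- by move=> x _; rewrite derive1E; case: (dF x).
Qed.

Lemma Cintegral_expi (m n : nat) :
  Cintegral 0 (2 * pi) (fun t => expi ((m%:Z - n%:Z)%:~R * t)) = ((m == n)%:R * (2 * pi))%:C :> R[i].
Proof.
have pi0 : (0 : R) < 2 * pi by rewrite mulr_gt0 ?pi_gt0.
set k : R := (m%:Z - n%:Z)%:~R.
have [mn|mn] := eqVneq m n.
  rewrite mul1r /k mn subrr /Cintegral /=.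
  have -> : (fun t : R => cos (0 * t)) = cst 1 by apply/funext => t; rewrite mul0r cos0.
  have -> : (fun t : R => sin (0 * t)) = cst 0 by apply/funext => t; rewrite mul0r sin0.
  rewrite !Rintegral_cst //= mul0r lebesgue_measure_itv /= lte_fin pi0.
  by rewrite -EFinB /= subr0 mul1r.
have k0 : k != 0 by rewrite intr_eq0 subr_eq0 eqz_nat.
(* The frequency [k] is an integer, so the primitives sin (k x) / k and - cos (k x) / k take equal
   values at 0 and 2 pi. *)
have e2 : expi (k * (2 * pi)) = 1.
  by rewrite /k expiMz expi2pi rmorph1 !expr1n mulr1.
have [c2 s2] : cos (k * (2 * pi)) = 1 /\ sin (k * (2 * pi)) = 0 by case: e2.
have [cre cim] := ccontinuous_expi k.
have dk (x : R) : is_derive x 1 (fun x : R => k * x) k.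
  have := is_deriveZ k (is_derive_id x (1 : R)).
  by rewrite /GRing.scale /= mulr1.
have dsin (x : R) : is_derive x 1 (fun x : R => k^-1 * sin (k * x)) (cos (k * x)).
  have h := is_derive1_comp (is_derive_sin (k * x)) (dk x).
  have := is_deriveZ k^-1 h.
  by rewrite /GRing.scale /= mulrCA mulVf ?mulr1.
have dcos (x : R) : is_derive x 1 (fun x : R => - k^-1 * cos (k * x)) (sin (k * x)).
  have h := is_derive1_comp (is_derive_cos (k * x)) (dk x).
  apply: (is_derive_eq (is_deriveZ (- k^-1) h)).
  by rewrite /GRing.scale /= mulNr mulrCA mulVf // mulr1 opprK.
rewrite mul0r /Cintegral; congr (_ +i* _).
- rewrite (@Rintegral_FTC _ _ _ _ pi0 cre dsin) //.
  by rewrite s2 !mulr0 sin0 mulr0 subrr.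
- rewrite (@Rintegral_FTC _ _ _ _ pi0 cim dcos) //.
  by rewrite c2 !mulr0 cos0 mulr1 subrr.
Qed.

Lemma Cintegral_pow (n : nat) :
  Cintegral 0 1 (fun r => (r ^+ n)%:C) = (n.+1%:R^-1)%:C :> R[i].
Proof.
have dp (x : R) : is_derive x 1 (fun x : R => n.+1%:R^-1 * x ^+ n.+1) (x ^+ n).
  have -> : (fun x : R => n.+1%:R^-1 * x ^+ n.+1) = n.+1%:R^-1 \*: (id ^+ n.+1 : R -> R).
    by apply/funext => y; rewrite /= exprfctE.
  apply: (is_derive_eq (is_deriveZ n.+1%:R^-1 (is_deriveX n.+1 (is_derive_id x (1 : R))))).
  by rewrite /GRing.scale /= mulr1 mulrA mulVf ?pnatr_eq0 // mul1r.
rewrite /Cintegral /= Rintegral_cst // mul0r; congr (_ +i* _).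
rewrite (@Rintegral_FTC _ _ _ _ ltr01 _ dp) ?expr1n ?expr0n /= ?mulr1 ?mulr0 ?subr0 //.
exact: exprn_continuous.
Qed.

End ComplexIntegral.

(** * Integrals of polynomials over the disk *)

Section DiskPolynomials.
Variable R : realType.
Notation C := R[i].
Implicit Types (f g : R -> R -> C) (r phi : R).

(** Unlike the monomials in x and y, these have a single angular frequency, a - b, and are permuted
    by conjugation. *)
Definition zmon (a b : nat) r phi : C := zc r phi ^+ a * Num.conj (zc r phi) ^+ b.

(** The weight r sits inside the angular integral, as in [inner], so that [inner f g] is by
    conversion the [diskint] of f times the conjugate of g. *)
Definition diskint f : C :=
  Cintegral 0 1 (fun r => Cintegral 0 (2 * pi) (fun phi => f r phi * r%:C)).

(** The identity is required for all real r and phi, not only polar ones, which makes [f] continuous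
    in phi on the whole line. Repeated exponents are allowed in the list, so that a sum is a
    concatenation. *)
Definition zpoly f := exists s : seq (C * (nat * nat)),
  forall r phi, f r phi = \sum_(x <- s) x.1 * zmon x.2.1 x.2.2 r phi.

Lemma zpoly_mon a b : zpoly (zmon a b).
Proof. by exists [:: (1, (a, b))] => r phi; rewrite big_seq1 mul1r. Qed.

Lemma zpolyZ c f : zpoly f -> zpoly (fun r phi => c * f r phi).
Proof.
move=> [s fs]; exists [seq (c * x.1, x.2) | x <- s] => r phi.
by rewrite fs big_map mulr_sumr; apply: eq_bigr => x _; rewrite mulrA.
Qed.

Lemma zpoly0 : zpoly (fun _ _ => 0).
Proof. by exists [::] => r phi; rewrite big_nil. Qed.

Lemma zpoly_sum (I : Type) (s : seq I) (P : pred I) (F : I -> R -> R -> C) :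
  (forall i, P i -> zpoly (F i)) -> zpoly (fun r phi => \sum_(i <- s | P i) F i r phi).
Proof.
move=> zF; elim: s => [|i s [t IH]].
  by exists [::] => r phi; rewrite !big_nil.
have [Pi|Pi] := boolP (P i); last first.
  by exists t => r phi; rewrite big_cons (negbTE Pi).
have [u Fu] := zF i Pi.
by exists (u ++ t) => r phi; rewrite big_cons Pi big_cat Fu IH.
Qed.

Lemma zmonM a b c d r phi :
  zmon a b r phi * zmon c d r phi = zmon (a + c) (b + d) r phi.
Proof. by rewrite /zmon mulrACA -!exprD. Qed.

Lemma conj_zmon a b r phi : Num.conj (zmon a b r phi) = zmon b a r phi.
Proof. by rewrite /zmon rmorphM !rmorphXn /= conjCK mulrC. Qed.

Lemma zpolyM f g : zpoly f -> zpoly g -> zpoly (fun r phi => f r phi * g r phi).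
Proof.
move=> [s fs] [t gt].
have -> : (fun r phi => f r phi * g r phi) = (fun r phi =>
    \sum_(x <- s) \sum_(y <- t) (x.1 * y.1) * zmon (x.2.1 + y.2.1) (x.2.2 + y.2.2) r phi).
  apply/funext => r; apply/funext => phi; rewrite fs gt big_distrlr /=.
  apply: eq_bigr => x _; apply: eq_bigr => y _.
  by rewrite -zmonM mulrACA.
by do 2 (apply: zpoly_sum => ? _); apply: zpolyZ; exact: zpoly_mon.
Qed.

Lemma zpoly_conj f : zpoly f -> zpoly (fun r phi => Num.conj (f r phi)).
Proof.
move=> [s fs]; exists [seq (Num.conj x.1, (x.2.2, x.2.1)) | x <- s] => r phi.
rewrite fs big_map rmorph_sum; apply: eq_bigr => x _ /=.
by rewrite rmorphM /= conj_zmon.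
Qed.

Lemma zmon_ccontinuous a b r : ccontinuous (zmon a b r).
Proof.
have -> : zmon a b r = (fun phi => (r ^+ (a + b))%:C * expi ((a%:Z - b%:Z)%:~R * phi)).
  by apply/funext => phi; exact: zc_monomialE.
by apply: ccontinuousM; [exact: ccontinuous_cst|exact: ccontinuous_expi].
Qed.

Lemma zpoly_ccontinuous f r : zpoly f -> ccontinuous (f r).
Proof.
move=> [s fs]; rewrite (_ : f r = fun phi => \sum_(x <- s) x.1 * zmon x.2.1 x.2.2 r phi); last first.
  by apply/funext => phi; exact: fs.
apply: ccontinuous_sum => x; apply: ccontinuousM; first exact: ccontinuous_cst.
exact: zmon_ccontinuous.
Qed.

(** The angular integral kills the terms of nonzero frequency, and for a = b the radial integral of
    r^(2a+1) is 1 / (2a + 2). Linearity of [diskint] on polynomials is then read off this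
    formula. *)
Lemma diskint_zmon_sum (s : seq (C * (nat * nat))) :
  diskint (fun r phi => \sum_(x <- s) x.1 * zmon x.2.1 x.2.2 r phi)
  = \sum_(x <- s) x.1 * ((x.2.1 == x.2.2)%:R * (pi / x.2.1.+1%:R))%:C.
Proof.
pose q (x : C * (nat * nat)) : C := x.1 * ((x.2.1 == x.2.2)%:R * (2 * pi))%:C.
transitivity (Cintegral 0 1 (fun r : R =>
    \sum_(x <- s) q x * (r ^+ (x.2.1 + x.2.2).+1)%:C)).
  apply: eq_Cintegral => r _.
  transitivity (Cintegral 0 (2 * pi) (fun phi : R => \sum_(x <- s)
      (x.1 * (r ^+ (x.2.1 + x.2.2).+1)%:C) * expi ((x.2.1%:Z - x.2.2%:Z)%:~R * phi))).
    apply: eq_Cintegral => phi _; rewrite mulr_suml; apply: eq_bigr => x _.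
    by rewrite /zmon zc_monomialE exprSr rmorphM /=; ring.
  rewrite Cintegral_sum; last by move=> x; exact: ccontinuous_expi.
  by apply: eq_bigr => x _; rewrite Cintegral_expi /q; ring.
rewrite Cintegral_sum; last first.
  by move=> x; apply: ccontinuous_real; exact: exprn_continuous.
apply: eq_bigr => -[c [a b]] _; rewrite Cintegral_pow /q /= -mulrA -rmorphM /=.
congr (_ * _%:C); have [->|] := eqVneq a b; last by rewrite !mul0r.
have -> : (b + b).+2%:R = 2 * b.+1%:R :> R by rewrite -!natr1 natrD; ring.
by field; rewrite ?pnatr_eq0.
Qed.

Lemma diskintD f g : zpoly f -> zpoly g ->
  diskint (fun r phi => f r phi + g r phi) = diskint f + diskint g.
Proof.
move=> [s fs] [t gt].
have -> : f = fun r phi => \sum_(x <- s) x.1 * zmon x.2.1 x.2.2 r phi.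
  by apply/funext => r; apply/funext => phi.
have -> : g = fun r phi => \sum_(x <- t) x.1 * zmon x.2.1 x.2.2 r phi.
  by apply/funext => r; apply/funext => phi.
rewrite !diskint_zmon_sum -big_cat -diskint_zmon_sum.
by congr diskint; apply/funext => r; apply/funext => phi; rewrite big_cat.
Qed.

Lemma diskintZ c f : zpoly f ->
  diskint (fun r phi => c * f r phi) = c * diskint f.
Proof.
move=> [s fs].
have -> : f = fun r phi => \sum_(x <- s) x.1 * zmon x.2.1 x.2.2 r phi.
  by apply/funext => r; apply/funext => phi.
rewrite diskint_zmon_sum mulr_sumr.
transitivity (diskint (fun r phi => \sum_(x <- [seq (c * x.1, x.2) | x <- s])
    x.1 * zmon x.2.1 x.2.2 r phi)).
  congr diskint; apply/funext => r; apply/funext => phi.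
  by rewrite big_map mulr_sumr; apply: eq_bigr => x _; rewrite mulrA.
by rewrite diskint_zmon_sum big_map; apply: eq_bigr => x _; rewrite -mulrA.
Qed.

Lemma diskint_sum (I : Type) (s : seq I) (F : I -> R -> R -> C) :
  (forall i, zpoly (F i)) ->
  diskint (fun r phi => \sum_(i <- s) F i r phi) = \sum_(i <- s) diskint (F i).
Proof.
move=> zF; elim: s => [|i s IH].
  rewrite big_nil; transitivity (diskint (fun _ _ => 0 * 0)); last first.
    by rewrite (diskintZ 0 zpoly0) mul0r.
  by congr diskint; apply/funext => r; apply/funext => phi; rewrite big_nil mulr0.
rewrite big_cons -IH -diskintD //; last exact: zpoly_sum.
by congr diskint; apply/funext => r; apply/funext => phi; rewrite big_cons.
Qed.

Lemma inner_zmon a b c d :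
  inner (zmon a b) (zmon c d) = ((a + d == b + c)%N%:R * (pi / (a + d).+1%:R))%:C.
Proof.
transitivity (diskint (fun r phi => \sum_(x <- [:: (1, ((a + d)%N, (b + c)%N))])
    x.1 * zmon x.2.1 x.2.2 r phi)); last by rewrite diskint_zmon_sum big_seq1 mul1r.
congr diskint; apply/funext => r; apply/funext => phi.
by rewrite big_seq1 mul1r conj_zmon zmonM.
Qed.

Lemma inner_suml (I : Type) (s : seq I) (c : I -> C) F g :
  (forall i, zpoly (F i)) -> zpoly g ->
  inner (fun r phi => \sum_(i <- s) c i * F i r phi) g
  = \sum_(i <- s) c i * inner (F i) g.
Proof.
move=> zF zg.
have zFg i : zpoly (fun r phi => F i r phi * Num.conj (g r phi)).
  by apply: zpolyM => //; exact: zpoly_conj.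
transitivity (diskint (fun r phi => \sum_(i <- s) c i * (F i r phi * Num.conj (g r phi)))).
  congr diskint; apply/funext => r; apply/funext => phi.
  by rewrite mulr_suml; apply: eq_bigr => i _; rewrite mulrA.
rewrite diskint_sum; last by move=> i; exact: zpolyZ.
by apply: eq_bigr => i _; rewrite diskintZ.
Qed.

Lemma inner_sumr (I : Type) (s : seq I) (c : I -> C) f G :
  zpoly f -> (forall i, zpoly (G i)) ->
  inner f (fun r phi => \sum_(i <- s) c i * G i r phi)
  = \sum_(i <- s) Num.conj (c i) * inner f (G i).
Proof.
move=> zf zG.
have zfG i : zpoly (fun r phi => f r phi * Num.conj (G i r phi)).
  by apply: zpolyM => //; exact: zpoly_conj.
transitivity (diskint (fun r phi =>
    \sum_(i <- s) Num.conj (c i) * (f r phi * Num.conj (G i r phi)))).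
  congr diskint; apply/funext => r; apply/funext => phi.
  rewrite rmorph_sum mulr_sumr; apply: eq_bigr => i _ /=.
  by rewrite rmorphM mulrCA.
rewrite diskint_sum; last by move=> i; exact: zpolyZ.
by apply: eq_bigr => i _; rewrite diskintZ.
Qed.

Definition eq_disk f g := forall r phi, polar r phi -> f r phi = g r phi.

(** Elements of V_N are known only at polar coordinates. This lemma replaces them by global
    polynomial representatives before computing. *)
Lemma eq_inner f f' g g' : zpoly f' -> zpoly g' -> eq_disk f f' -> eq_disk g g' ->
  inner f g = inner f' g'.
Proof.
move=> zf zg ff gg; apply: eq_Cintegral => r; rewrite in_itv /= => r01.
apply: eq_Cintegral_co.
  apply: ccontinuousM; last exact: ccontinuous_cst.
  exact: (zpoly_ccontinuous r (zpolyM zf (zpoly_conj zg))).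
by move=> phi; rewrite in_itv /= => phi01; rewrite ff ?gg.
Qed.

End DiskPolynomials.

(** * Orthonormality of the Zernike polynomials *)

Section PolynomialIntegral.
Variable F : numFieldType.
Implicit Types (f g U : {poly F}).

(** The integral over [0, 1], defined on coefficients so that the orthogonality of the radial parts,
    in the variable r^2, is pure algebra. *)
Definition pint f : F := \sum_(i < size f) f`_i / i.+1%:R.

Lemma pint_wide n f : (size f <= n)%N -> pint f = \sum_(i < n) f`_i / i.+1%:R.
Proof.
move=> fn; rewrite /pint (big_ord_widen n (fun i => f`_i / i.+1%:R) fn).
rewrite [RHS](bigID (fun i : 'I_n => (i < size f)%N)) /= [X in _ + X]big1 ?addr0 //.
by move=> i; rewrite -leqNgt => fi; rewrite nth_default // mul0r.
Qed.

Lemma pintD f g : pint (f + g) = pint f + pint g.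
Proof.
pose n := maxn (size f) (size g).
rewrite (@pint_wide n f) ?leq_maxl // (@pint_wide n g) ?leq_maxr //.
rewrite (@pint_wide n) ?size_polyD // -big_split; apply: eq_bigr => i _.
by rewrite coefD mulrDl.
Qed.

Lemma pintZ c f : pint (c *: f) = c * pint f.
Proof.
rewrite (@pint_wide (size f)) ?size_scale_leq // mulr_sumr.
by apply: eq_bigr => i _; rewrite coefZ mulrA.
Qed.

Lemma pint_mulrn f n : pint (f *+ n) = n%:R * pint f.
Proof. by rewrite -pintZ scaler_nat. Qed.

Lemma pint0 : pint 0 = 0.
Proof. by rewrite /pint size_poly0 big_ord0. Qed.

Lemma pint_sum n (h : 'I_n -> {poly F}) : pint (\sum_i h i) = \sum_i pint (h i).
Proof. by elim/big_ind2: _ => [|x1 x2 y1 y2 <- <-|//]; rewrite ?pint0 ?pintD. Qed.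

Lemma pintXn n : pint 'X^n = n.+1%:R^-1.
Proof.
rewrite (@pint_wide n.+1) ?size_polyXn // big_ord_recr /= coefXn eqxx mul1r big1 ?add0r //.
by move=> i _; rewrite coefXn ltn_eqF ?mul0r.
Qed.

Lemma pint_deriv f : pint f^`() = f.[1] - f.[0].
Proof.
rewrite (@pint_wide (size f).-1); last first.
  have [->|f0] := eqVneq f 0; first by rewrite linear0 size_poly0.
  by rewrite -ltnS (leq_trans (lt_size_deriv f0)) // leqSpred.
rewrite (@horner_coef_wide _ (size f).-1.+1) ?leqSpred // big_ord_recl.
rewrite horner_coef0 expr0 mulr1 addrC addKr.
apply: eq_bigr => i _; rewrite coef_deriv expr1n mulr1 -(mulr_natr f`_i.+1) mulfK //.
Qed.

Lemma pint_by_parts f g : pint (f^`() * g)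
  = f.[1] * g.[1] - f.[0] * g.[0] - pint (f * g^`()).
Proof. by rewrite -!hornerM -pint_deriv derivM pintD addrK. Qed.

(** Each integration by parts has no boundary term, since X (X - 1) vanishes at 0 and 1. The free
    factor [U] lets the induction go through: differentiating removes one factor X (X - 1) and only
    changes [U]. *)
Lemma pint_by_parts_iter k U g :
  pint ((('X * ('X - 1)) ^+ k * U)^`(k) * g)
  = (-1) ^+ k * pint (('X * ('X - 1)) ^+ k * U * g^`(k)).
Proof.
elim: k U => [|k IH] U; first by rewrite !derivn0 !expr0 !mul1r.
set h := 'X * ('X - 1); set f := h ^+ k.+1 * U.
have f1 : f.[1] = 0 by rewrite /f /h !hornerE subrr !(mulr0, mul0r, expr0n).
have f0 : f.[0] = 0 by rewrite /f /h !hornerE !(mulr0, mul0r, expr0n).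
have df : f^`() = h ^+ k * (h^`() *+ k.+1 * U + h * U^`()).
  rewrite /f derivM deriv_exp exprSr /= -mulr_natr -(mulr_natr h^`()).
  by move: h^`() U^`() (h ^+ k) (k.+1%:R : {poly F}) => a b c d; ring.
rewrite derivSn df IH -df pint_by_parts f1 f0 !mul0r subrr sub0r exprS mulN1r.
by rewrite -derivnS mulNr mulrN.
Qed.

(** The Beta integral; one integration by parts trades a factor 1 - X for a factor X. *)
Lemma pint_beta p q : pint ('X^p * (1 - 'X) ^+ q) = (p`! * q`!)%:R / (p + q).+1`!%:R.
Proof.
elim: q p => [|q IH] p.
  rewrite mulr1 pintXn addn0 muln1 factS natrM.
  have p0 : p`!%:R != 0 :> F by rewrite pnatr_eq0 -lt0n fact_gt0.
  by rewrite invfM mulrCA mulfV // mulr1.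
have e : p.+1%:R * pint ('X^p * (1 - 'X) ^+ q.+1)
    = q.+1%:R * pint ('X^(p.+1) * (1 - 'X) ^+ q).
  have := pint_by_parts 'X^(p.+1) ((1 - 'X) ^+ q.+1).
  rewrite derivXn deriv_exp derivB derivX derivC sub0r !hornerE /=.
  rewrite expr1n expr0n subrr expr0n /= mulr0 mul0r subrr sub0r.
  rewrite [X in pint X = _ -> _](_ : _ = p.+1%:R *: ('X^p * (1 - 'X) ^+ q.+1)); last first.
    by rewrite mulrnAl scaler_nat.
  rewrite [X in - pint X](_ : _ = (- q.+1%:R) *: ('X^(p.+1) * (1 - 'X) ^+ q)); last first.
    by rewrite mulN1r mulNrn mulrN mulrnAr scaleNr scaler_nat.
  by rewrite !pintZ mulNr opprK.
have p0 : p.+1%:R != 0 :> F by rewrite pnatr_eq0.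
apply: (mulfI p0); rewrite e IH addSnnS !factS !natrM.
have f0 : ((p + q).+2)`!%:R != 0 :> F by rewrite pnatr_eq0 -lt0n fact_gt0.
by ring.
Qed.

End PolynomialIntegral.

(** * Coefficients of the disk polynomials: Rodrigues formula and moments *)

Section DiskCoefficients.

(** For s at most min p q this is (p + q - s)! / (s! (p - s)! (q - s)!). The product of binomials is
    the form produced by the Rodrigues formula; it is a natural number and vanishes for larger s. *)
Definition zbin (p q s : nat) : nat := 'C(q, s) * 'C(p + q - s, q).

Lemma zbin_fact p q s : (s <= p)%N -> (s <= q)%N ->
  (zbin p q s * (s`! * (p - s)`! * (q - s)`!))%N = (p + q - s)`!.
Proof.
move=> sp sq; have h1 := bin_fact sq.
have h2 : (q <= p + q - s)%N by lia.
have := bin_fact h2; rewrite (_ : p + q - s - q = p - s)%N; last lia.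
by rewrite -h1 /zbin => <-; lia.
Qed.

Lemma zbin_small p q s : (minn p q < s)%N -> zbin p q s = 0%N.
Proof.
rewrite /zbin gtn_min => /orP[h|h]; last by rewrite bin_small.
have [sq|sq] := leqP s q; last by rewrite bin_small.
by rewrite [X in (_ * X)%N]bin_small ?muln0 //; lia.
Qed.

Lemma zbinC p q s : zbin p q s = zbin q p s.
Proof.
have [h|h] := leqP s (minn p q); last by rewrite !zbin_small // minnC.
move: h; rewrite leq_min => /andP[sp sq].
have := zbin_fact sp sq; have := zbin_fact sq sp; rewrite (addnC q p) => <-.
have f0 : (0 < s`! * (p - s)`! * (q - s)`!)%N by rewrite !muln_gt0 !fact_gt0.
by move=> e; apply/eqP; rewrite -(eqn_pmul2r f0) e; apply/eqP; lia.
Qed.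

Variable F : numFieldType.

Definition zcoef (p q s : nat) : F := (-1) ^+ s * (zbin p q s)%:R.

Lemma zcoefC p q s : zcoef p q s = zcoef q p s.
Proof. by rewrite /zcoef zbinC. Qed.

(** Expand X^p (X - 1)^q by the binomial theorem; the q-th derivative divided by q!, [nderivn],
    sends X^(p+q-s) to 'C(p + q - s, q) X^(p-s). *)
Lemma zcoef_rodrigues p q : (q <= p)%N ->
  (('X * ('X - 1)) ^+ q * 'X^(p - q))^`N(q)
  = \sum_(s < q.+1) zcoef p q s *: 'X^(p - s) :> {poly F}.
Proof.
move=> qp.
have -> : ('X * ('X - 1)) ^+ q * 'X^(p - q)
    = \sum_(s < q.+1) ((-1) ^+ s * 'C(q, s)%:R) *: 'X^(p + q - s) :> {poly F}.
  rewrite exprMn mulrAC -exprD subnKC // exprBn mulr_sumr.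
  apply: eq_bigr => s _; rewrite expr1n mulr1 -mulr_natr.
  have -> : (p + q - s)%N = (p + (q - s))%N by have := ltn_ord s; lia.
  rewrite exprD -mul_polyC rmorphM rmorphXn rmorphN1 /= polyC_natr; ring.
rewrite linear_sum; apply: eq_bigr => s _ /=.
rewrite linearZ /= nderivnXn -(scaler_nat _ 'X^_) scalerA /zcoef /zbin natrM mulrA.
by congr (_ *: 'X^_); lia.
Qed.

(** For q <= p the sum is the integral of the Rodrigues polynomial against X^d. Moving the q
    derivatives onto X^d leaves 0 if d < q and a Beta integral if d = q. The first hypothesis says
    that (p, q) and (c, d) have the same angular frequency. *)
Lemma zcoef_moment p q c d : (p + d = q + c)%N -> (d <= q)%N ->
  \sum_(s < (minn p q).+1) zcoef p q s / (p - s + d).+1%:R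
  = (d == q)%:R * ((p`! * q`!)%:R / (p + q).+1`!%:R).
Proof.
(* Exchanging (p, c) with (q, d) amounts to complex conjugation and preserves the statement. *)
wlog qp : p q c d / (q <= p)%N => [hwlog|] pdqc dq.
  have [qp|pq] := orP (leq_total q p); first exact: (hwlog p q c d qp pdqc dq).
  have cp : (c <= p)%N by lia.
  have := hwlog q p d c pq (esym pdqc) cp.
  rewrite minnC (mulnC q`!) (addnC q) (_ : (c == p) = (d == q)); last by lia.
  move=> <-; apply: eq_bigr => s _; rewrite zcoefC.
  have := ltn_ord s; rewrite ltnS leq_min => /andP[sp sq].
  by congr (_ / _%:R); lia.
move=> {c pdqc}; rewrite (minn_idPr qp).
pose W : {poly F} := ('X * ('X - 1)) ^+ q * 'X^(p - q).
have q0 : q`!%:R != 0 :> F by rewrite pnatr_eq0 -lt0n fact_gt0.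
(* The factor q! turns the divided derivative of the Rodrigues formula into an ordinary one. *)
apply: (mulfI q0).
transitivity (pint (W^`(q) * 'X^d)).
  rewrite nderivn_def zcoef_rodrigues // [X in pint X]mulrnAl pint_mulrn mulr_suml pint_sum.
  congr (_ * _); apply: eq_bigr => s _. by rewrite -[in RHS]scalerAl pintZ -exprD pintXn.
rewrite pint_by_parts_iter derivnXn.
have [->|dq'] := eqVneq d q; last first.
  by rewrite ffact_small ?mulr0n ?mulr0 ?pint0 ?mulr0 ?mul0r ?mulr0 // ltn_neqAle dq'.
rewrite ffactnn subnn expr0 [X in pint X]mulrnAr mulr1 pint_mulrn mul1r mulrCA; congr (_ * _).
rewrite -pint_beta -pintZ; congr pint.
rewrite exprMn mulrAC -exprD subnKC // scalerAr; congr (_ * _).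
by rewrite -mul_polyC rmorphXn rmorphN1 -exprMn mulN1r opprB.
Qed.

End DiskCoefficients.

(** * Zernike polynomials in the indices p and q *)

Section ZernikeOrthonormal.
Variable R : realType.
Notation C := R[i].
Implicit Types (r phi : R) (p q n t : nat).

Definition zd p q : R -> R -> C := zernike (p + q) (p%:Z - q%:Z).

Definition znorm p q : R := Num.sqrt ((p + q).+1%:R / pi).

Lemma zernike_az n t : (t <= n)%N -> zernike n (az n t) = zd t (n - t) :> (R -> R -> C).
Proof.
move=> tn; rewrite /zd subnKC //; congr zernike.
by rewrite /az -subzn //; lia.
Qed.

(** With n = p + q and m = p - q, the term r^(n-2s) e^{i m phi} is z^(p-s) zbar^(q-s), while (n -
    |m|) / 2 and (n + |m|) / 2 are the minimum and maximum of p and q. *)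
Lemma zd_disk p q r phi : zd p q r phi
  = (znorm p q)%:C * \sum_(s < (minn p q).+1) (zcoef R p q s)%:C * zmon (p - s) (q - s) r phi.
Proof.
rewrite /zd /zernike rmorphM -mulrA; congr (_ * _).
set k := `|_|%N.
have kE : k = (maxn p q - minn p q)%N by rewrite /k; lia.
have e1 : ((p + q - k) %/ 2 = minn p q)%N by rewrite kE; lia.
have e2 : ((p + q + k) %/ 2 = maxn p q)%N by rewrite kE; lia.
rewrite /radial e1 e2 rmorph_sum mulr_suml; apply: eq_bigr => s _ /=.
have := ltn_ord s; rewrite ltnS leq_min => /andP[sp sq].
rewrite /zmon zc_monomialE mulrA -rmorphM.
rewrite (_ : ((p - s)%N%:Z - (q - s)%N%:Z) = p%:Z - q%:Z); last by lia.
rewrite (_ : (p - s + (q - s) = p + q - 2 * s)%N); last by lia.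
congr ((_ * _)%:C * _).
rewrite /zcoef -mulrA; congr (_ * _).
move: (nat_of_ord s) sp sq => {e1 e2} {}s sp sq.
have f0 : ((s`! * (maxn p q - s)`! * (minn p q - s)`!)%:R : R) != 0.
  by rewrite pnatr_eq0 -lt0n !muln_gt0 !fact_gt0.
apply: (mulIf f0); rewrite divfK // -natrM -(zbin_fact sp sq); congr (_%:R).
by have [pq|qp] := leqP p q; rewrite // (mulnAC s`!).
Qed.

Lemma zpoly_zd p q : zpoly (zd p q).
Proof.
rewrite (_ : zd p q = fun r phi => (znorm p q)%:C *
   \sum_(s < (minn p q).+1) (zcoef R p q s)%:C * zmon (p - s) (q - s) r phi).
  by apply: zpolyZ; apply: zpoly_sum => s _; apply: zpolyZ; exact: zpoly_mon.
by apply/funext => r; apply/funext => phi; exact: zd_disk.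
Qed.

Lemma zd_sumE p q : zd p q = fun r phi => \sum_(s < (minn p q).+1)
  ((znorm p q)%:C * (zcoef R p q s)%:C) * zmon (p - s) (q - s) r phi.
Proof.
apply/funext => r; apply/funext => phi; rewrite zd_disk mulr_sumr.
by apply: eq_bigr => s _; rewrite mulrA.
Qed.

(** Distinct frequencies are separated by the angular integral. For equal frequencies the degree
    bound gives d <= q, and the inner product is a multiple of the moment computed in
    [zcoef_moment]. *)
Lemma inner_zd_zmon p q c d : (c + d <= p + q)%N ->
  inner (zd p q) (zmon c d)
  = (((c == p) && (d == q))%:R * (znorm p q * (pi * ((p`! * q`!)%:R / (p + q).+1`!%:R))))%:C.
Proof.
move=> cd; rewrite {1}zd_sumE inner_suml; [|by move=> i; exact: zpoly_mon|exact: zpoly_mon].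
have [pdqc|pdqc] := eqVneq (p + d)%N (q + c)%N; last first.
  rewrite (_ : _ && _ = false) ?mul0r; last by apply/negbTE; lia.
  apply: big1 => s _; rewrite inner_zmon (_ : _ == _ = false) ?mul0r ?mulr0 //.
  have := ltn_ord s; rewrite ltnS leq_min => /andP[sp sq].
  by apply/negbTE; lia.
have dq : (d <= q)%N by lia.
rewrite (_ : (c == p) && (d == q) = (d == q)); last by lia.
rewrite mulrCA (mulrCA _ pi) -(zcoef_moment R pdqc dq) !mulr_sumr rmorph_sum.
apply: eq_bigr => s _; rewrite inner_zmon.
have := ltn_ord s; rewrite ltnS leq_min => /andP[sp sq].
rewrite (_ : _ == _ = true); last by lia.
by rewrite mul1r -!rmorphM /=; congr (_%:C); ring.
Qed.

Lemma inner_conj (f g : R -> R -> C) : zpoly f -> zpoly g ->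
  inner f g = Num.conj (inner g f).
Proof.
move=> [s fs] [t gt].
have -> : f = fun r phi => \sum_(x <- s) x.1 * zmon x.2.1 x.2.2 r phi.
  by apply/funext => r; apply/funext => phi.
have -> : g = fun r phi => \sum_(x <- t) x.1 * zmon x.2.1 x.2.2 r phi.
  by apply/funext => r; apply/funext => phi.
have zm (x : C * (nat * nat)) : zpoly (@zmon R x.2.1 x.2.2) by exact: zpoly_mon.
rewrite inner_suml //; last by apply: zpoly_sum => i _; exact: zpolyZ.
rewrite inner_sumr //; last by apply: zpoly_sum => i _; exact: zpolyZ.
rewrite rmorph_sum; apply: eq_bigr => x _ /=.
rewrite inner_sumr // inner_suml // rmorphM /= conjCK; congr (_ * _).
rewrite rmorph_sum; apply: eq_bigr => y _ /=; rewrite rmorphM /=; congr (_ * _).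
rewrite !inner_zmon conj_realC eq_sym (addnC y.2.2) (addnC y.2.1).
congr (_%:C); case: eqVneq => [e|_]; last by rewrite !mul0r.
by rewrite e.
Qed.

Lemma zd_orthonormal p q p' q' :
  inner (zd p q) (zd p' q') = ((p == p') && (q == q'))%:R.
Proof.
wlog h : p q p' q' / (p' + q' <= p + q)%N => [hwlog|].
  have [h|h] := orP (leq_total (p' + q') (p + q)); first exact: hwlog.
  rewrite inner_conj; [|exact: zpoly_zd|exact: zpoly_zd].
  by rewrite hwlog // rmorph_nat (eq_sym p) (eq_sym q).
rewrite (zd_sumE p' q') inner_sumr; [|exact: zpoly_zd|by move=> i; exact: zpoly_mon].
(* Only the leading monomial of the second polynomial, of lower or equal degree, can pair
   nontrivially with the first: those with s > 0 have total degree below p + q. *)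
rewrite big_ord_recl big1 ?addr0 => [|s _]; last first.
  rewrite inner_zd_zmon; last by rewrite /= /bump; lia.
  rewrite (_ : _ && _ = false) ?mul0r ?mulr0 //.
  have := ltn_ord s; rewrite ltn_min /= /bump => /andP[sp sq].
  by apply/negbTE; lia.
rewrite !subn0 inner_zd_zmon //.
rewrite (eq_sym p') (eq_sym q'); case: eqVneq => [<-|_] /=; last by rewrite mul0r mulr0.
case: eqVneq => [<-|_] /=; last by rewrite mul0r mulr0.
rewrite mul1r -rmorphM conj_realC -rmorphM /zcoef expr0 mul1r; congr (_ +i* _).
(* The squared norm is [znorm]^2 times pi times this product over (p + q + 1)!, which is 1. *)
have hz : ((zbin p q 0)%:R * (p`! * q`!)%:R = (p + q)`!%:R :> R).
  by rewrite -natrM; have := @zbin_fact p q 0 isT isT; rewrite fact0 mul1n !subn0 => ->.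
have n0 : (p + q)`!%:R != 0 :> R by rewrite pnatr_eq0 -lt0n fact_gt0.
have sq : znorm p q * znorm p q = (p + q).+1%:R / pi.
  by rewrite -expr2 sqr_sqrtr // divr_ge0 ?ler0n ?pi_ge0.
rewrite factS (natrM _ (p + q).+1).
transitivity ((znorm p q * znorm p q) * (pi * (((zbin p q 0)%:R * (p`! * q`!)%:R)
    / ((p + q).+1%:R * (p + q)`!%:R)))).
  by ring.
have n1 : (p + q).+1%:R != 0 :> R by rewrite pnatr_eq0.
have pi0 : (pi : R) != 0 by rewrite gt_eqF ?pi_gt0.
rewrite sq hz; move: (pi : R) (p + q)`!%:R (p + q).+1%:R pi0 n0 n1 => x y z x0 y0 z0.
by field; rewrite x0 y0 z0.
Qed.

End ZernikeOrthonormal.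

(** * The Zernike polynomials span V_N *)

Section DiskSubspaces.
Variable R : realType.
Notation C := R[i].
Notation fn := (R -> R -> C).
Implicit Types (f g : fn) (W : set fn) (G : nat -> nat -> fn).

(** The first clause makes membership depend only on the values on the disk; the others say that W
    is a linear subspace. *)
Definition disk_subspace W := [/\ forall f g, eq_disk f g -> W g -> W f,
  W (fun _ _ => 0),
  forall f g, W f -> W g -> W (fun r phi => f r phi + g r phi)
  & forall c f, W f -> W (fun r phi => c * f r phi)].

Lemma subspace_sum W (I : Type) (s : seq I) (P : pred I) (c : I -> C) (F : I -> fn) :
  disk_subspace W -> (forall i, P i -> W (F i)) ->
  W (fun r phi => \sum_(i <- s | P i) c i * F i r phi).
Proof.
move=> [We W0 WD WZ] WF; elim: s => [|i s IH].
  by apply: We W0 => r phi _; rewrite big_nil.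
have [Pi|Pi] := boolP (P i).
  apply: We (WD _ _ (WZ (c i) _ (WF i Pi)) IH) => r phi _.
  by rewrite big_cons Pi.
by apply: We IH => r phi _; rewrite big_cons (negbTE Pi).
Qed.

(** Taken with G equal to [xymon], [zmon] or [zd], it gives the three descriptions of V_N to be
    compared. *)
Definition bispan G N : set fn := [set f | exists c : nat -> nat -> C,
  eq_disk f (fun r phi => \sum_(a < N.+1) \sum_(b < N.+1 | (a + b <= N)%N)
    c a b * G a b r phi)].

Lemma bispan_subspace G N : disk_subspace (bispan G N).
Proof.
split.
- by move=> f g fg [c gc]; exists c => r phi h; rewrite fg // gc.
- exists (fun _ _ => 0) => r phi _; rewrite big1 // => a _.
  by rewrite big1 // => b _; rewrite mul0r.
- move=> f g [c fc] [d gd]; exists (fun a b => c a b + d a b) => r phi h.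
  rewrite fc // gd // -big_split; apply: eq_bigr => a _ /=.
  by rewrite -big_split; apply: eq_bigr => b _ /=; rewrite mulrDl.
- move=> k f [c fc]; exists (fun a b => k * c a b) => r phi h.
  rewrite fc // mulr_sumr; apply: eq_bigr => a _.
  by rewrite mulr_sumr; apply: eq_bigr => b _; rewrite mulrA.
Qed.

Lemma bispan_gen G N p q : (p + q <= N)%N -> bispan G N (G p q).
Proof.
move=> pq; have pN : (p < N.+1)%N by lia.
have qN : (q < N.+1)%N by lia.
exists (fun a b => ((a == p) && (b == q))%:R) => r phi _.
rewrite (bigD1 (Ordinal pN)) //= [X in _ + X]big1 ?addr0 => [|a ap]; last first.
  rewrite big1 // => b _; rewrite (_ : _ && _ = false) ?mul0r //.
  by apply: contraNF ap => /andP[/eqP e _]; apply/eqP/val_inj.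
rewrite (bigD1 (Ordinal qN)) //= [X in _ + X]big1 ?addr0 => [|b /andP[_ bq]]; last first.
  rewrite (_ : _ && _ = false) ?mul0r //.
  by apply: contraNF bq => /andP[_ /eqP e]; apply/eqP/val_inj.
by rewrite !eqxx mul1r.
Qed.

(** The span is the least subspace containing its generators, so inclusions are tested on generators
    only. *)
Lemma bispan_sub G N W : disk_subspace W ->
  (forall p q, (p + q <= N)%N -> W (G p q)) -> bispan G N `<=` W.
Proof.
move=> sW GW f [c fc]; have [We W0 WD WZ] := sW; apply: (We _ _ fc).
have h := subspace_sum (index_enum 'I_N.+1) (fun=> 1) sW (P := xpredT)
  (F := fun a : 'I_N.+1 => fun r phi => \sum_(b < N.+1 | (a + b <= N)%N) c a b * G a b r phi).
apply: We (h _); first by move=> r phi _; apply: eq_bigr => a _; rewrite mul1r.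
move=> a _; apply: (subspace_sum (index_enum 'I_N.+1) (fun b : 'I_N.+1 => c a b) sW
  (P := fun b : 'I_N.+1 => (a + b <= N)%N) (F := fun b : 'I_N.+1 => G a b)).
by move=> b; exact: GW.
Qed.

Lemma bispan_mono G M N : (M <= N)%N -> bispan G M `<=` bispan G N.
Proof.
move=> MN; apply: bispan_sub; first exact: bispan_subspace.
by move=> p q pq; apply: bispan_gen; exact: leq_trans MN.
Qed.

(** The preimage of a subspace under multiplication by h; through it [bispan_sub] also handles
    products h f. *)
Lemma subspace_mul (h : fn) W : disk_subspace W ->
  disk_subspace [set f | W (fun r phi => h r phi * f r phi)].
Proof.
move=> [We W0 WD WZ]; split => /=.
- by move=> f g fg; apply: We => r phi p; rewrite fg.
- by apply: We W0 => r phi _; rewrite mulr0.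
- by move=> f g Wf Wg; apply: We (WD _ _ Wf Wg) => r phi _; rewrite mulrDr.
- by move=> c f Wf; apply: We (WZ c _ Wf) => r phi _; rewrite mulrCA.
Qed.

Lemma bispan_mul (h : fn) G N :
  (forall p q, bispan G (p + q).+1 (fun r phi => h r phi * G p q r phi)) ->
  forall f, bispan G N f -> bispan G N.+1 (fun r phi => h r phi * f r phi).
Proof.
move=> hG; apply: bispan_sub; first exact/subspace_mul/bispan_subspace.
by move=> p q pq /=; apply: (@bispan_mono _ (p + q).+1); [lia|exact: hG].
Qed.

Definition xymon (a b : nat) : fn := fun r phi =>
  (r * cos phi)%:C ^+ a * (r * sin phi)%:C ^+ b.

Lemma VE N : V N = bispan xymon N.
Proof.
by apply/seteqP; split=> f [c fc]; exists c => r phi h; rewrite fc //;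
  apply: eq_bigr => a _; apply: eq_bigr => b _; rewrite ?mulrA -?mulrA.
Qed.

Lemma V_subspace N : disk_subspace (V N).
Proof. by rewrite VE; exact: bispan_subspace. Qed.

Lemma V_mulx N f : V N f -> V N.+1 (fun r phi => (r * cos phi)%:C * f r phi).
Proof.
rewrite !VE; move: f; apply: bispan_mul => p q.
have [We _ _ _] := bispan_subspace xymon (p + q).+1.
apply: We (@bispan_gen xymon _ p.+1 q _) => // r phi _.
by rewrite /xymon exprS mulrA.
Qed.

Lemma V_muly N f : V N f -> V N.+1 (fun r phi => (r * sin phi)%:C * f r phi).
Proof.
rewrite !VE; move: f; apply: bispan_mul => p q.
have [We _ _ _] := bispan_subspace xymon (p + q).+1.
apply: We (@bispan_gen xymon _ p q.+1 _) => [r phi _|]; last by rewrite addnS.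
by rewrite /xymon exprS mulrCA.
Qed.

Lemma zc_xy (r phi : R) : zc r phi = (r * cos phi)%:C + 'i%C * (r * sin phi)%:C.
Proof. by rewrite zc_re_im [LHS]complexE. Qed.

Lemma conj_zc_xy (r phi : R) :
  Num.conj (zc r phi) = (r * cos phi)%:C - 'i%C * (r * sin phi)%:C.
Proof.
by rewrite zc_re_im conj_complexE -mulNr; apply/eqP; rewrite eq_complex /=; apply/andP; split; apply/eqP; ring.
Qed.

Lemma xyE (r phi : R) :
  (r * cos phi)%:C = 2^-1 * zc r phi + 2^-1 * Num.conj (zc r phi) /\
  (r * sin phi)%:C = (- 'i%C / 2) * zc r phi + ('i%C / 2) * Num.conj (zc r phi).
Proof.
rewrite conj_zc_xy zc_xy.
have i2 : 'i%C * 'i%C = -1 :> C by rewrite -expr2 sqr_i.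
have two0 : 2 != 0 :> C by rewrite pnatr_eq0.
set i := 'i%C in i2 *; move: (r * cos phi)%:C (r * sin phi)%:C => x y; split; first by field.
transitivity (- (i * i) * y); first by rewrite i2 opprK mul1r.
by field.
Qed.

Lemma zmon_mulz N f : bispan (@zmon R) N f ->
  bispan (@zmon R) N.+1 (fun r phi => zc r phi * f r phi).
Proof.
move: f; apply: bispan_mul => p q.
have [We _ _ _] := bispan_subspace (@zmon R) (p + q).+1.
by apply: We (@bispan_gen (@zmon R) _ p.+1 q _) => // r phi _; rewrite /zmon exprS mulrA.
Qed.

Lemma zmon_mulzc N f : bispan (@zmon R) N f ->
  bispan (@zmon R) N.+1 (fun r phi => Num.conj (zc r phi) * f r phi).
Proof.
move: f; apply: bispan_mul => p q.
have [We _ _ _] := bispan_subspace (@zmon R) (p + q).+1.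
apply: We (@bispan_gen (@zmon R) _ p q.+1 _) => [r phi _|]; last by rewrite addnS.
by rewrite /zmon exprS mulrCA.
Qed.

(** Induction on the exponents, multiplying by z = x + i y or zbar = x - i y. [V_sub_zmon] runs the
    same argument backwards, with x and y written in z and zbar. *)
Lemma zmon_in_V p q : V (p + q) (@zmon R p q).
Proof.
elim: p => [|p IH].
  elim: q => [|q IH].
    have [We _ _ _] := V_subspace 0; rewrite VE in We *.
    by apply: We (bispan_gen _ (p := 0) (q := 0) _) => // r phi _; rewrite /zmon /xymon !expr0.
  rewrite addnS; have [We _ WD WZ] := V_subspace (0 + q).+1.
  apply: We (WD _ _ (V_mulx IH) (WZ (- 'i%C) _ (V_muly IH))) => r phi _.
  by rewrite /zmon exprS mulrCA conj_zc_xy mulrBl !mulNr !mulrA.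
rewrite addSn; have [We _ WD WZ] := V_subspace (p + q).+1.
apply: We (WD _ _ (V_mulx IH) (WZ ('i%C) _ (V_muly IH))) => r phi _.
by rewrite /zmon exprS -mulrA zc_xy mulrDl !mulrA.
Qed.

Lemma V_sub_zmon N : V N `<=` bispan (@zmon R) N.
Proof.
rewrite VE; apply: bispan_sub; first exact: bispan_subspace.
move=> p q pq; apply: (bispan_mono pq) => {pq}.
elim: p => [|p IH].
  elim: q => [|q IH].
    have [We _ _ _] := bispan_subspace (@zmon R) 0.
    by apply: We (bispan_gen _ (p := 0) (q := 0) _) => // r phi _; rewrite /zmon /xymon !expr0.
  rewrite addnS; have [We _ WD WZ] := bispan_subspace (@zmon R) (0 + q).+1.
  apply: We (WD _ _ (WZ (- 'i%C / 2) _ (zmon_mulz IH)) (WZ ('i%C / 2) _ (zmon_mulzc IH))) => r phi _.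
  by rewrite /xymon exprS mulrCA (xyE r phi).2 mulrDl !mulrA.
rewrite addSn; have [We _ WD WZ] := bispan_subspace (@zmon R) (p + q).+1.
apply: We (WD _ _ (WZ 2^-1 _ (zmon_mulz IH)) (WZ 2^-1 _ (zmon_mulzc IH))) => r phi _.
by rewrite /xymon exprS -mulrA (xyE r phi).1 mulrDl !mulrA.
Qed.

Lemma zd_in_V p q : V (p + q) (@zd R p q).
Proof.
rewrite zd_sumE; apply: subspace_sum; first exact: V_subspace.
move=> s _; rewrite VE; apply: (@bispan_mono _ (p - s + (q - s))); first lia.
by rewrite -VE; exact: zmon_in_V.
Qed.

(** Triangularity: [zd p q] is a nonzero multiple [a 0] of z^p zbar^q plus monomials of smaller
    degree, which strong induction on the degree already places in the span. *)
Lemma zmon_in_zd p q : bispan (@zd R) (p + q) (@zmon R p q).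
Proof.
have [n] := ubnP (p + q); elim: n p q => // n IH p q; rewrite ltnS => pqn.
have sW := bispan_subspace (@zd R) (p + q); have [We _ WD WZ] := sW.
pose a s : C := (znorm R p q)%:C * (zcoef R p q s)%:C.
have a0 : a 0%N != 0.
  rewrite /a /zcoef expr0 mul1r -rmorphM /= (_ : 0 = 0%:C) // (inj_eq (@complexI R)).
  rewrite mulf_neq0 // ?pnatr_eq0.
    by rewrite sqrtr_eq0 -ltNge divr_gt0 ?pi_gt0 ?ltr0n.
  have := @zbin_fact p q 0 isT isT; have := fact_gt0 (p + q).
  by rewrite !subn0 => + e; rewrite -e muln_gt0 => /andP[]; rewrite lt0n.
pose rest : fn := fun r phi => \sum_(s < minn p q)
   (- a s.+1) * zmon (p - s.+1) (q - s.+1) r phi.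
have Wrest : bispan (@zd R) (p + q) rest.
  apply: subspace_sum => // s _; have := ltn_ord s; rewrite ltn_min => /andP[sp sq].
  by apply: (@bispan_mono _ (p - s.+1 + (q - s.+1))); [lia|apply: IH; lia].
apply: We (WZ (a 0%N)^-1 _ (WD _ _ (bispan_gen (@zd R) (leqnn (p + q))) Wrest)) => r phi _.
rewrite zd_sumE big_ord_recl /= !subn0 -/(a 0%N) -addrA /rest -big_split big1 ?addr0 ?mulKf //.
by move=> s _ /=; rewrite mulNr subrr.
Qed.

Lemma V_sub_zd N : V N `<=` bispan (@zd R) N.
Proof.
apply: (subset_trans (@V_sub_zmon N)); apply: bispan_sub; first exact: bispan_subspace.
by move=> p q pq; apply: (bispan_mono pq); exact: zmon_in_zd.
Qed.

End DiskSubspaces.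

(** * Zernike coordinates on V_N and the reproducing kernel *)

Section ZernikeModes.
Variable R : realType.
Notation C := R[i].
Notation fn := (R -> R -> C).
Implicit Types (f g : fn) (N : nat).

Lemma size_zernike_modes N : size (zernike_modes N) = dimV N.
Proof.
rewrite /zernike_modes size_allpairs_dep.
have -> : map (fun n => size (iota 0 n.+1)) (iota 0 N.+1) = map S (iota 0 N.+1).
  by apply: eq_map => n; rewrite size_iota.
suff h : (sumn (map S (iota 0 N.+1)) * 2 = N.+1 * N.+2)%N by rewrite /dimV -h mulnK.
elim: N => [//|N IH].
by rewrite -addn1 iotaD map_cat sumn_cat mulnDl IH /=; lia.
Qed.

Lemma uniq_zernike_modes N : uniq (zernike_modes N).
Proof.
apply: allpairs_uniq_dep; first exact: iota_uniq.
  by move=> n _; exact: iota_uniq.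
move=> [n t] [n' t'] /= _ _ [e]; rewrite -{n'}e => h.
by have -> : t = t' by move: h; rewrite /az; lia.
Qed.

Lemma mem_zernike_modes N n t : (n <= N)%N -> (t <= n)%N ->
  (n, az n t) \in zernike_modes N.
Proof.
by move=> nN tn; apply: (allpairs_f_dep (fun n t => (n, az n t))); rewrite mem_iota.
Qed.

Lemma zernike_modesP N (s : 'I_(dimV N)) : exists p q, (p + q <= N)%N /\
  nth (0%N, 0) (zernike_modes N) s = ((p + q)%N, p%:Z - q%:Z).
Proof.
have : nth (0%N, 0) (zernike_modes N) s \in zernike_modes N.
  by rewrite mem_nth // size_zernike_modes.
move=> /allpairsPdep[n [t]] [].
rewrite !mem_iota /= !add0n !ltnS => nN tn ->.
exists t, (n - t)%N; rewrite subnKC //; split=> //; congr pair.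
by rewrite /az -subzn //; lia.
Qed.

Lemma zernike1_zd N (s : 'I_(dimV N)) : exists p q, (p + q <= N)%N /\
  zernike1 N s = zd p q :> fn.
Proof.
have [p [q [pqN e]]] := zernike_modesP s.
by exists p, q; split => //; rewrite /zernike1 e.
Qed.

Lemma zpoly_zernike1 N (s : 'I_(dimV N)) : zpoly (@zernike1 R N s).
Proof. by have [p [q [_ ->]]] := zernike1_zd s; exact: zpoly_zd. Qed.

Lemma zernike1_in_V N (s : 'I_(dimV N)) : V N (@zernike1 R N s).
Proof.
have [p [q [pqN ->]]] := zernike1_zd s.
by rewrite VE; apply: (bispan_mono pqN); rewrite -VE; exact: zd_in_V.
Qed.

(** The listed modes are distinct, and (p + q, p - q) determines (p, q), so equal positions
    correspond to equal index pairs. *)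
Lemma zernike1_orthonormal N (s s' : 'I_(dimV N)) :
  inner (@zernike1 R N s) (zernike1 N s') = (s == s')%:R.
Proof.
have [p [q [_ e]]] := zernike_modesP s; have [p' [q' [_ e']]] := zernike_modesP s'.
have -> : zernike1 N s = zd p q :> fn by rewrite /zernike1 e.
have -> : zernike1 N s' = zd p' q' :> fn by rewrite /zernike1 e'.
rewrite zd_orthonormal; congr (nat_of_bool _)%:R.
have -> : (s == s') = (((p + q)%N, p%:Z - q%:Z) == ((p' + q')%N, p'%:Z - q'%:Z)).
  by rewrite -e -e' nth_uniq ?size_zernike_modes ?uniq_zernike_modes.
by rewrite xpair_eqE; apply/idP/idP; lia.
Qed.

Lemma sum_zernike_modes N (A : nmodType) (F : nat -> int -> A) :
  \sum_(n < N.+1) \sum_(t < n.+1) F n (az n t)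
  = \sum_(s < dimV N) let nm := nth (0%N, 0) (zernike_modes N) s in F nm.1 nm.2.
Proof.
transitivity (\sum_(nm <- zernike_modes N) F nm.1 nm.2).
  rewrite /zernike_modes big_allpairs_dep -(big_mkord xpredT (fun n => \sum_(t < n.+1) F n (az n t))).
  rewrite /index_iota subn0; apply: eq_bigr => n _.
  by rewrite -(big_mkord xpredT (fun t => F n (az n t))) /index_iota subn0.
by rewrite (big_nth (0%N, 0)) size_zernike_modes big_mkord.
Qed.

Lemma kernel_polyE N rho theta r phi : kernel_poly N rho theta r phi
  = \sum_(s < dimV N) Num.conj (zernike1 N s rho theta) * zernike1 N s r phi :> C.
Proof.
exact: (sum_zernike_modes N (fun n m => Num.conj (zernike n m rho theta) * zernike n m r phi)).
Qed.

Definition zcomb N (a : 'I_(dimV N) -> C) : fn :=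
  fun r phi => \sum_s a s * zernike1 N s r phi.

Lemma zcomb_subspace N : disk_subspace [set f | exists a : 'I_(dimV N) -> C, eq_disk f (zcomb a)].
Proof.
split => /=.
- by move=> f g fg [a ga]; exists a => r phi h; rewrite fg // ga.
- by exists (fun=> 0) => r phi _; rewrite /zcomb big1 // => s _; rewrite mul0r.
- move=> f g [a fa] [b gb]; exists (fun s => a s + b s) => r phi h.
  by rewrite fa // gb // /zcomb -big_split; apply: eq_bigr => s _; rewrite mulrDl.
- move=> c f [a fa]; exists (fun s => c * a s) => r phi h.
  by rewrite fa // /zcomb mulr_sumr; apply: eq_bigr => s _; rewrite mulrA.
Qed.

Lemma V_zcomb N f : V N f -> exists a : 'I_(dimV N) -> C, eq_disk f (zcomb a).
Proof.
move=> /V_sub_zd; move: f; apply: bispan_sub; first exact: zcomb_subspace.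
move=> p q pqN /=; have pN : (p <= p + q)%N by lia.
pose m := ((p + q)%N, az (p + q) p).
have mm : m \in zernike_modes N by apply: mem_zernike_modes.
have im : (index m (zernike_modes N) < dimV N)%N by rewrite -size_zernike_modes index_mem.
have zm : zernike1 N (Ordinal im) = zd p q :> fn.
  by rewrite /zernike1 /= nth_index // /m /= zernike_az // addKn.
exists (fun s => (s == Ordinal im)%:R) => r phi _.
rewrite /zcomb (bigD1 (Ordinal im)) //= eqxx mul1r big1 ?addr0 ?zm // => s /negbTE ->.
by rewrite mul0r.
Qed.

Lemma zcomb_in_V N (a : 'I_(dimV N) -> C) : V N (zcomb a).
Proof.
by apply: subspace_sum => [|s _]; [exact: V_subspace|exact: zernike1_in_V].
Qed.

Lemma zpoly_zcomb N (a : 'I_(dimV N) -> C) : zpoly (zcomb a).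
Proof. by apply: zpoly_sum => s _; apply: zpolyZ; exact: zpoly_zernike1. Qed.

(** Parseval's identity: in Zernike coordinates the inner product on V_N becomes the standard
    Hermitian form. *)
Lemma inner_zcomb N (a b : 'I_(dimV N) -> C) :
  inner (zcomb a) (zcomb b) = \sum_s a s * Num.conj (b s).
Proof.
rewrite inner_suml; [|by move=> s; exact: zpoly_zernike1|exact: zpoly_zcomb].
apply: eq_bigr => s _; congr (_ * _).
rewrite inner_sumr; [|exact: zpoly_zernike1|by move=> t; exact: zpoly_zernike1].
rewrite (bigD1 s) //= zernike1_orthonormal eqxx mulr1 big1 ?addr0 // => t /negbTE ts.
by rewrite zernike1_orthonormal eq_sym ts mulr0.
Qed.

Lemma zcomb_eq0 N (a : 'I_(dimV N) -> C) :
  eq_disk (zcomb a) (fun _ _ => 0) -> forall s, a s = 0.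
Proof.
move=> za s; have : inner (zcomb a) (zernike1 N s) = 0.
  have z0 : eq_disk (zcomb a) (zcomb (fun _ : 'I_(dimV N) => 0)).
    by move=> r phi p; rewrite za // /zcomb big1 // => i _; rewrite mul0r.
  rewrite (eq_inner (zpoly_zcomb _) (zpoly_zernike1 s) z0 (fun _ _ _ => erefl)).
  rewrite inner_suml; [|by move=> i; exact: zpoly_zernike1|exact: zpoly_zernike1].
  by rewrite big1 // => i _; rewrite mul0r.
rewrite inner_suml; [|by move=> i; exact: zpoly_zernike1|exact: zpoly_zernike1].
rewrite (bigD1 s) //= zernike1_orthonormal eqxx mulr1 big1 ?addr0 // => i /negbTE si.
by rewrite zernike1_orthonormal si mulr0.
Qed.

Lemma kernel_zcomb N rho theta : kernel_poly N rho theta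
  = zcomb (fun s : 'I_(dimV N) => Num.conj (@zernike1 R N s rho theta)).
Proof. by apply/funext => r; apply/funext => phi; exact: kernel_polyE. Qed.

(** The Zernike coordinates of the kernel are the conjugates of the values Z_s(rho, theta), so
    Parseval's identity gives back the expansion of f at that point. *)
Lemma kernel_reproducing N f rho theta : V N f -> polar rho theta ->
  inner f (kernel_poly N rho theta) = f rho theta.
Proof.
move=> /V_zcomb[a fa] pP; rewrite kernel_zcomb.
rewrite (eq_inner (zpoly_zcomb a) (zpoly_zcomb _) fa (fun _ _ _ => erefl)).
rewrite inner_zcomb fa //; apply: eq_bigr => s _; by rewrite conjCK.
Qed.

Lemma inner_kernel N f rho theta : V N f -> polar rho theta ->
  inner (kernel_poly N rho theta) f = Num.conj (f rho theta).
Proof.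
move=> Vf pP; have [a fa] := V_zcomb Vf.
rewrite kernel_zcomb (eq_inner (zpoly_zcomb _) (zpoly_zcomb a) (fun _ _ _ => erefl) fa).
rewrite inner_zcomb fa // rmorph_sum; apply: eq_bigr => s _ /=.
by rewrite [RHS]rmorphM /= mulrC.
Qed.

End ZernikeModes.

(** * Unisolvence at the regular points *)

Section ConcentricCircles.
Variables (R : realType) (N : nat) (c : nat -> nat -> R[i]).
Notation C := R[i].

Definition bipoly (z : C) : C :=
  \sum_(a < N.+1) \sum_(b < N.+1 | (a + b <= N)%N) c a b * (z ^+ a * Num.conj z ^+ b).

(** The index e encodes the angular frequency e - N, shifted to be a natural number; the two
    truncated subtractions add up to |e - N|. *)
Definition freq (e : nat) : nat := (e - N + (N - e))%N.

(** The polynomial h_m for m = e - N: it collects the terms with a - b = m, since z^a zbar^b = r^|m|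
    (r^2)^(minn a b) e^{i m phi}. *)
Definition mode (e : nat) : {poly C} :=
  \sum_(a < N.+1) \sum_(b < N.+1 | (a + b <= N)%N)
    if (N + a == e + b)%N then c a b *: 'X^(minn a b) else 0.

Lemma size_mode e : (size (mode e) <= ((N - freq e) %/ 2).+1)%N.
Proof.
apply: (leq_trans (size_sum _ _ _)); apply/bigmax_leqP => a _.
apply: (leq_trans (size_sum _ _ _)); apply/bigmax_leqP => b ab.
case: eqP => [e1|_]; last by rewrite size_poly0.
apply: (leq_trans (size_scale_leq _ _)); rewrite size_polyXn ltnS.
by rewrite /freq; lia.
Qed.

(** On a circle zbar is inverse to z up to scaling; the factor u^N clears the negative frequencies
    and leaves a polynomial in u of degree at most 2N. *)
Lemma bipoly_modes (x : R) (u : C) : u * Num.conj u = 1 ->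
  u ^+ N * bipoly (x%:C * u)
  = \sum_(e < N.*2.+1) (x%:C ^+ freq e * (mode e).[(x ^+ 2)%:C]) * u ^+ e.
Proof.
move=> u1.
transitivity (\sum_(e < N.*2.+1) \sum_(a < N.+1) \sum_(b < N.+1 | (a + b <= N)%N)
   if (N + a == e + b)%N then c a b * x%:C ^+ (a + b) * u ^+ e else 0); last first.
  apply: eq_bigr => e _; rewrite /mode horner_sum mulr_sumr mulr_suml.
  apply: eq_bigr => a _; rewrite horner_sum mulr_sumr mulr_suml.
  apply: eq_bigr => b ab; case: eqP => [e1|_]; last by rewrite horner0 mulr0 mul0r.
  rewrite hornerZ hornerXn rmorphXn -exprM mulrCA -exprD; congr (_ * _ ^+ _ * _).
  by rewrite /freq; lia.
rewrite exchange_big /= /bipoly mulr_sumr; apply: eq_bigr => a _.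
rewrite exchange_big /= mulr_sumr; apply: eq_bigr => b ab.
(* The pair (a, b) contributes to exactly one index, e = N + a - b. *)
have eN : (N + a - b < N.*2.+1)%N by have := ltn_ord a; have := ltn_ord b; lia.
rewrite (bigD1 (Ordinal eN)) //= [X in _ + X]big1 ?addr0 => [|e en]; last first.
  by case: eqP => // e1; case/eqP: en; apply: val_inj => /=; lia.
rewrite (_ : _ == _); last by apply/eqP; have := ltn_ord a; have := ltn_ord b; lia.
rewrite rmorphM /= conj_realC !exprMn exprD.
have key : u ^+ N * (u ^+ a * Num.conj u ^+ b) = u ^+ (N + a - b).
  have bN : (b <= N)%N by lia.
  rewrite -{1}(subnK bN) exprD -mulrA (mulrCA (u ^+ b)) -exprMn u1 expr1n mulr1 -exprD.
  by congr (_ ^+ _); lia.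
by rewrite -key; ring.
Qed.

(** Circles are numbered from 0 here, so that circle l carries 2N + 1 - 4l = 2 (N - 2l) + 1 points.
    Its radius may vanish only when 2l = N. *)
Variables (lam : nat -> R) (u : nat -> nat -> C).
Hypothesis lam_ge0 : forall l, (2 * l <= N)%N -> 0 <= lam l.
Hypothesis lam_gt0 : forall l, (2 * l < N)%N -> 0 < lam l.
Hypothesis lam_decr : forall l l', (l < l')%N -> (2 * l' <= N)%N -> lam l' < lam l.
Hypothesis u_unit : forall l t, u l t * Num.conj (u l t) = 1.
Hypothesis u_inj : forall l t t', (2 * l <= N)%N ->
  (t < 2 * N + 1 - 4 * l)%N -> (t' < 2 * N + 1 - 4 * l)%N -> u l t = u l t' -> t = t'.
Hypothesis zeros : forall l t, (2 * l <= N)%N -> (t < 2 * N + 1 - 4 * l)%N ->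
  bipoly ((lam l)%:C * u l t) = 0.

Let modeval l e : C := (lam l)%:C ^+ freq e * (mode e).[(lam l ^+ 2)%:C].

(** With d = (N - |e - N|) / 2 rounded down, [mode e] has degree at most d and d + 1 distinct roots,
    the squared radii of circles 0 to d. *)
Lemma mode_eq0 e : (freq e <= N)%N ->
  (forall l, (2 * l <= N - freq e)%N -> modeval l e = 0) -> mode e = 0.
Proof.
move=> eN ev; pose d := ((N - freq e) %/ 2)%N.
apply: (@roots_geq_poly_eq0 _ _ [seq (lam l ^+ 2)%:C | l <- iota 0 d.+1]).
- apply/allP => _ /mapP[l + ->]; rewrite mem_iota add0n ltnS => /= ld.
  have le : (2 * l <= N - freq e)%N by rewrite /d in ld; lia.
  have /eqP := ev l le; rewrite /modeval mulf_eq0 => /orP[|//].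
  rewrite expf_eq0 (_ : 0 = 0%:C) // (inj_eq (@complexI R)) => /andP[f0].
  (* The factor r^|m| could vanish only for m nonzero at the centre; but then 2l <= N - |m| < N and
     the radius is positive. *)
  by rewrite gt_eqF // lam_gt0 //; lia.
- rewrite map_inj_in_uniq ?iota_uniq // => l l'.
  rewrite !mem_iota !add0n !ltnS => /= ld ld' /complexI.
  have hl m : (m <= d)%N -> (2 * m <= N)%N by rewrite /d; lia.
  move=> /eqP; rewrite eqrXn2 ?lam_ge0 ?hl // => /eqP ll.
  have [h|h|//] := ltngtP l l'.
    by have := lam_decr h (hl _ ld'); rewrite ll ltxx.
  by have := lam_decr h (hl _ ld); rewrite ll ltxx.
- by rewrite size_map size_iota size_mode.
Qed.

(* On the [l]-th circle only the frequencies at most [N - 2 l] can still occur,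
   so that [2 (N - 2 l) + 1] zeros annihilate the trigonometric polynomial. *)
Lemma modeval_eq0 l e : (2 * l <= N)%N -> (freq e + 2 * l <= N)%N -> modeval l e = 0.
Proof.
elim/ltn_ind: l e => l IH e lN eN.
(* Such a frequency needs only circles l' with 2l' <= N - |m| < 2l, all covered by the induction
   hypothesis. *)
have high e' : (e' <= N.*2)%N -> (N < freq e' + 2 * l)%N -> mode e' = 0.
  move=> e'N e'l; have f' : (freq e' <= N)%N by rewrite /freq; lia.
  by apply: mode_eq0 => // l' l'e; apply: IH; lia.
pose n := (2 * N + 1 - 4 * l)%N.
pose Q : {poly C} := \poly_(i < N.*2.+1) modeval l i.
pose P : {poly C} := \poly_(i < n) modeval l (i + 2 * l).
(* [Q] is the circle restriction multiplied by u^N. Its lowest 2l and highest 2l coefficients belong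
   to frequencies beyond N - 2l, so only the n coefficients of [P] remain, against n distinct
   zeros. *)
have QP : Q = 'X^(2 * l) * P.
  apply/polyP => i; rewrite coefXnM !coef_poly.
  have z0 : (i <= N.*2)%N -> (N < freq i + 2 * l)%N -> modeval l i = 0.
    by move=> iN il; rewrite /modeval high // horner0 mulr0.
  case: (ltnP i (2 * l)) => il.
    by case: ltnP => // iN; apply: z0 => //; rewrite /freq; lia.
  rewrite subnK //; case: ltnP => iN; case: ltnP => jn //.
    by apply: z0 => //; move: jn; rewrite /n /freq; lia.
  by move: jn; rewrite /n; lia.
have P0 : P = 0.
  apply: (@roots_geq_poly_eq0 _ _ [seq u l t | t <- iota 0 n]).
  - apply/allP => _ /mapP[t + ->]; rewrite mem_iota add0n => /= tn.
    have u0 : u l t != 0.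
      by apply/eqP => e0; have /eqP := u_unit l t; rewrite e0 mul0r eq_sym oner_eq0.
    have := bipoly_modes (lam l) (u_unit l t); rewrite zeros // mulr0 => h.
    have : Q.[u l t] = 0 by rewrite h horner_poly.
    by rewrite QP hornerM hornerXn => /eqP; rewrite mulf_eq0 expf_eq0 (negbTE u0) andbF.
  - rewrite map_inj_in_uniq ?iota_uniq // => t t'.
    by rewrite !mem_iota !add0n => /= tn tn'; exact: u_inj.
  - by rewrite size_map size_iota size_poly.
have : Q`_e = 0 by rewrite QP P0 mulr0 coef0.
by rewrite coef_poly ifT //; move: eN; rewrite /freq; lia.
Qed.

Lemma bipoly_eq0 (x : R) (v : C) : v * Num.conj v = 1 -> bipoly (x%:C * v) = 0.
Proof.
move=> v1; have v0 : v != 0.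
  by apply/eqP => e0; have /eqP := v1; rewrite e0 mul0r eq_sym oner_eq0.
have m0 e : (e < N.*2.+1)%N -> mode e = 0.
  move=> eN; have f' : (freq e <= N)%N by rewrite /freq; lia.
  by apply: mode_eq0 => // l le; apply: modeval_eq0; lia.
apply: (mulfI (expf_neq0 N v0)); rewrite mulr0 bipoly_modes // big1 // => e _.
by rewrite m0 // horner0 mulr0 mul0r.
Qed.

End ConcentricCircles.

(** * Radii and angles of the regular points, and unisolvence *)

Section RegularPoints.
Variable R : realType.
Notation C := R[i].
Implicit Types (N : nat).

Lemma expi_eq1 (d : R) : 0 <= d < 2 * pi -> expi d = 1 -> d = 0.
Proof.
move=> /andP[d0 d2] [cd _]; have : cos (d / 2 *+ 2) = 1 by rewrite -mulr_natr divfK.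
(* By the half-angle formula cos d = 1 forces sin (d / 2) = 0, while d / 2 lies in [0, pi). *)
rewrite cos_mulr2n cos2sin2 => h.
have /eqP : sin (d / 2) ^+ 2 = 0 by move: h; rewrite mulr2n; lra.
rewrite sqrf_eq0 => /eqP s0.
move: d0; rewrite le_eqVlt => /orP[/eqP -> //|d0].
have : 0 < sin (d / 2) by apply: sin_gt0_pi; apply/andP; split; lra.
by rewrite s0 ltxx.
Qed.

Lemma expi_equispaced_inj (alpha : R) (n t t' : nat) : (t < n)%N -> (t' < n)%N ->
  expi (alpha + 2 * pi * t%:R / n%:R) = expi (alpha + 2 * pi * t'%:R / n%:R) -> t = t'.
Proof.
wlog tt : t t' / (t' <= t)%N => [hwlog|tn _ e].
  move=> tn tn' e; have [h|h] := orP (leq_total t' t); first exact: hwlog.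
  by apply/esym/hwlog.
have n0 : (0 : R) < n%:R by rewrite ltr0n; lia.
pose d : R := 2 * pi * (t - t')%:R / n%:R.
have ed : expi d = 1.
  apply: (mulfI (expi_neq0 (alpha + 2 * pi * t'%:R / n%:R))).
  rewrite mulr1 -expiD -e; congr expi; rewrite /d natrB //.
  by field; rewrite gt_eqF.
have d0 : d = 0.
  apply: expi_eq1 ed; rewrite /d; apply/andP; split.
    by rewrite !mulr_ge0 ?ler0n ?pi_ge0 ?invr_ge0 // ltW.
  rewrite ltr_pdivrMr // ltr_pM2l ?mulr_gt0 ?pi_gt0 //.
  by rewrite ltr_nat; lia.
move: d0 => /eqP; rewrite /d !mulf_eq0 invr_eq0 !(gt_eqF n0) (gt_eqF (pi_gt0 R)).
by rewrite !pnatr_eq0 /= orbF => h; lia.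
Qed.

(** The hypothesis on b says that the derivative a - 2 b x + 3 c x^2 has negative discriminant. *)
Lemma cubic_incr (a b c x y : R) : 0 < a -> 0 < c -> b ^+ 2 < 3 * a * c -> x < y ->
  a * x - b * x ^+ 2 + c * x ^+ 3 < a * y - b * y ^+ 2 + c * y ^+ 3.
Proof.
move=> a0 c0 bac xy; rewrite -subr_gt0.
have -> : a * y - b * y ^+ 2 + c * y ^+ 3 - (a * x - b * x ^+ 2 + c * x ^+ 3)
   = (y - x) * (a - b * (x + y) + c * (x ^+ 2 + x * y + y ^+ 2)) by ring.
rewrite mulr_gt0 ?subr_gt0 //.
(* Multiplying the difference quotient by 12 c turns it into a positive constant plus squares. *)
rewrite -(pmulr_rgt0 _ (mulr_gt0 (ltr0Sn R 11) c0)).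
have -> : 12 * c * (a - b * (x + y) + c * (x ^+ 2 + x * y + y ^+ 2))
   = 4 * (3 * a * c - b ^+ 2) + (2 * b - 3 * c * (x + y)) ^+ 2 + 3 * (c * (x - y)) ^+ 2 by ring.
have := sqr_ge0 (2 * b - 3 * c * (x + y)); have := sqr_ge0 (c * (x - y)).
lra.
Qed.

Definition radius (x : R) : R := (115 * 10 ^+ 2 + 65) / 10 ^+ 4 * x
  - (765 * 10 ^+ 2 + 35) / 10 ^+ 5 * x ^+ 2 + (605 * 10 ^+ 2 + 17) / 10 ^+ 5 * x ^+ 3.

Lemma radius_incr (x y : R) : x < y -> radius x < radius y.
Proof. by apply: cubic_incr; lra. Qed.

Lemma radius0 : radius 0 = 0.
Proof. by rewrite /radius !expr0n /= !mulr0 subrr add0r. Qed.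

Lemma zeta_angle N l : (2 * l <= N)%N ->
  0 <= (2 * l.+1%:R - 1) * (pi : R) / (2 * N.+1%:R) <= (pi : R) / 2.
Proof.
move=> lN; have pi0 := pi_gt0 R; have n0 : (0 : R) < 2 * N.+1%:R by rewrite mulr_gt0 // ltr0n.
have -> : 2 * l.+1%:R - 1 = (2 * l).+1%:R :> R by rewrite -!natr1 natrM; ring.
apply/andP; split; first by rewrite divr_ge0 ?mulr_ge0 ?ler0n ?ltW.
rewrite ler_pdivrMr // mulrA divfK // mulrC ler_pM2l // ler_nat.
by lia.
Qed.

Lemma zeta_decr N l l' : (l < l')%N -> (2 * l' <= N)%N -> zeta N l'.+1 < zeta N l.+1 :> R.
Proof.
move=> ll lN; have pi0 := pi_gt0 R; have n0 : (0 : R) < 2 * N.+1%:R by rewrite mulr_gt0 // ltr0n.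
have /andP[h1 h2] := zeta_angle lN.
have /andP[h3 h4] : 0 <= (2 * l.+1%:R - 1) * (pi : R) / (2 * N.+1%:R) <= (pi : R) / 2.
  by apply: zeta_angle; lia.
have pi2 : (pi : R) / 2 <= pi by lra.
rewrite /zeta ltr_cos ?in_itv /= ?h1 ?h3 /= ?(le_trans h2) ?(le_trans h4) //.
rewrite ltr_pM2r ?invr_gt0 // ltr_pM2r // ltrD2r ltr_pM2l //.
by rewrite ltr_nat ltnS.
Qed.

Lemma zeta_ge0 N l : (2 * l <= N)%N -> 0 <= zeta N l.+1 :> R.
Proof.
move=> lN; have /andP[h1 h2] := zeta_angle lN; apply: cos_ge0_pihalf.
by rewrite h2 andbT (le_trans _ h1) // oppr_le0 divr_ge0 ?pi_ge0.
Qed.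

Lemma zeta_gt0 N l : (2 * l < N)%N -> 0 < zeta N l.+1 :> R.
Proof.
move=> lN; have pi0 := pi_gt0 R; have n0 : (0 : R) < 2 * N.+1%:R by rewrite mulr_gt0 // ltr0n.
have /andP[h1 h2] := zeta_angle (ltnW lN); apply: cos_gt0_pihalf; apply/andP; split.
  by rewrite (lt_le_trans _ h1) // oppr_lt0 divr_gt0.
have -> : 2 * l.+1%:R - 1 = (2 * l).+1%:R :> R by rewrite -!natr1 natrM; ring.
rewrite ltr_pdivrMr // mulrA divfK // mulrC ltr_pM2l // ltr_nat.
by lia.
Qed.

Lemma lambda_ge0 N l : (2 * l <= N)%N -> 0 <= lambda N l.+1 :> R.
Proof.
move=> lN; have := zeta_ge0 lN; rewrite le_eqVlt => /orP[/eqP e|z0].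
  by rewrite (_ : lambda N l.+1 = radius (zeta N l.+1)) // -e radius0.
by apply/ltW; rewrite -radius0; exact: radius_incr.
Qed.

Lemma lambda_gt0 N l : (2 * l < N)%N -> 0 < lambda N l.+1 :> R.
Proof. by move=> lN; rewrite -radius0; apply: radius_incr; exact: zeta_gt0. Qed.

Lemma lambda_decr N l l' : (l < l')%N -> (2 * l' <= N)%N ->
  lambda N l'.+1 < lambda N l.+1 :> R.
Proof. by move=> ll lN; apply: radius_incr; exact: zeta_decr. Qed.

(** Uniqueness of interpolation, from [bipoly_eq0] applied to f written in z and zbar; circle l
    there is circle l + 1 of the regular points. *)
Lemma regular_unisolvent N (rho theta : 'I_(dimV N) -> R) (f : R -> R -> C) :
  regular_points rho theta -> V N f -> (forall j, f (rho j) (theta j) = 0) ->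
  eq_disk f (fun _ _ => 0).
Proof.
move=> [pol _ [alpha rg]] /V_sub_zmon[c fc] f0 r phi prp.
rewrite fc //.
pose u l t : C := expi (alpha l.+1 + 2 * pi * t%:R / (2 * N + 5 - 4 * l.+1)%:R).
apply: (@bipoly_eq0 R N c (fun l => lambda N l.+1) u).
- exact: lambda_ge0.
- exact: lambda_gt0.
- exact: lambda_decr.
- by move=> l t; exact: expiMconj.
- move=> l t t' lN tn tn'; apply: expi_equispaced_inj; lia.
- move=> l t lN tn.
  have : [set p | exists i t : nat,
           [/\ (1 <= i <= (N %/ 2).+1)%N, (t < 2 * N + 5 - 4 * i)%N
             & p = cart (lambda N i)
                     (alpha i + 2 * pi * t%:R / (2 * N + 5 - 4 * i)%:R)]]
     (cart (lambda N l.+1) (alpha l.+1 + 2 * pi * t%:R / (2 * N + 5 - 4 * l.+1)%:R)).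
    by exists l.+1, t; split => //; lia.
  rewrite -rg => -[j _ [ex ey]].
  have -> : (lambda N l.+1)%:C * u l t = zc (rho j) (theta j).
    by rewrite -/(zc _ _) !zc_re_im ex ey.
  by have := f0 j; rewrite fc; [|exact: pol].
- exact: expiMconj.
Qed.

(** A kernel vector is the coordinate vector of an element of V_N vanishing at every node;
    unisolvence makes that element zero, and linear independence makes the vector zero. *)
Lemma zernike_mx_unit N (rho theta : 'I_(dimV N) -> R) :
  regular_points rho theta -> zernike_mx rho theta \in unitmx.
Proof.
move=> hP; rewrite -unitmx_tr -row_free_unit -kermx_eq0; apply/rowV0P => v.
rewrite sub_kermx => /eqP vA.
pose a s := v 0 s.
apply/rowP => s; rewrite mxE; apply: (zcomb_eq0 (a := a)) s.
apply: (regular_unisolvent hP); first exact: zcomb_in_V.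
move=> j; have /rowP/(_ j) := vA; rewrite !mxE => <-.
by apply: eq_bigr => s _; rewrite !mxE.
Qed.

End RegularPoints.

(** * The three-term recurrence and the Christoffel-Darboux formula *)

Section ThreeTermCoefficients.
Variable F : numFieldType.
Implicit Types p q s : nat.

(** Coefficients in |z|^2 D_{p,q} = up D_{p+1,q+1} + mid D_{p,q} + down D_{p-1,q-1} for the
    unnormalised disk polynomials. They add up to 1 because every D takes the value 1 at z = 1. *)
Definition rec_up p q : F := (p.+1%:R * q.+1%:R) / ((p + q).+2%:R * (p + q).+1%:R).
Definition rec_down p q : F := (p%:R * q%:R) / ((p + q)%:R * (p + q).+1%:R).
Definition rec_mid p q : F := 1 - rec_up p q - rec_down p q.

(** Coefficients of D_{p,q}, and below of D_{p-1,q-1}, on the monomial z^(p+1-s) zbar^(q+1-s),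
    whence the index shifts by one and two. *)
Definition zcoef_prev p q s : F := if s is s'.+1 then zcoef F p q s' else 0.
Definition zcoef_prev2 p q s : F := if s is s'.+2 then zcoef F p.-1 q.-1 s' else 0.

(* The factor [y] turns [(p + q - s)!] into [X], and so covers the boundary case
   [s = p + q + 1]. *)
Lemma zcoef_fact p q s (D := (s`! * (p.+1 - s)`! * (q.+1 - s)`!)%:R : F)
    (X := ((p + q).+1 - s)`!%:R : F) (y := ((p + q).+1 - s)%:R : F) :
  (s <= (minn p q).+1)%N ->
  [/\ y * zcoef F p q s * D = (-1) ^+ s * X * ((p.+1 - s)%:R * (q.+1 - s)%:R),
      zcoef F p.+1 q.+1 s * D = (-1) ^+ s * X * (y + 1),
      zcoef_prev p q s * D = - ((-1) ^+ s * X * s%:R)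
    & (0 < p)%N -> (0 < q)%N ->
      y * zcoef_prev2 p q s * D = (-1) ^+ s * X * (s%:R * (s%:R - 1))].
Proof.
move=> sm; have [sp sq] : (s <= p.+1 /\ s <= q.+1)%N by lia.
split.
- have [sm1|sm1] := leqP s (minn p q); last first.
    rewrite /zcoef zbin_small // !mulr0 mul0r.
    have : ((p.+1 - s = 0) \/ (q.+1 - s = 0))%N by lia.
    by case=> ->; rewrite ?mul0r !mulr0.
  have [sp' sq'] : (s <= p /\ s <= q)%N by lia.
  have sn : ((p + q).+1 - s = (p + q - s).+1)%N by lia.
  have := zbin_fact sp' sq'; rewrite /zcoef /D /X /y sn !subSn // !factS => <-.
  by rewrite !natrM; ring.
- have sn : (p.+1 + q.+1 - s = ((p + q).+1 - s).+1)%N by lia.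
  have := zbin_fact sp sq; rewrite sn factS => e.
  rewrite /zcoef /D /X /y -[LHS]mulrA -natrM e natrM -natr1; ring.
- case: s @D @X @y sm sp sq => [|s] D X y sm sp sq; first by rewrite mul0r mulr0 oppr0.
  rewrite /= /D /X !subSS /zcoef factS exprS.
  have [sp' sq'] : (s <= p /\ s <= q)%N by lia.
  by rewrite -(zbin_fact sp' sq') !natrM; ring.
- move=> p0 q0; case: s @D @X @y sm sp sq => [|[|s]] D X y sm sp sq.
  + by rewrite /= !mulr0 !mul0r mulr0.
  + by rewrite /= mulr0 mul0r subrr !mulr0.
  case: p q p0 q0 sm sp sq @D @X @y => [//|p] [//|q] _ _ sm sp sq D X y.
  have [sp' sq'] : (s <= p /\ s <= q)%N by lia.
  have sn : ((p.+1 + q.+1).+1 - s.+2 = (p + q - s).+1)%N by lia.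
  rewrite /= /D /X /y sn !subSS /zcoef !factS -(zbin_fact sp' sq') !exprS !natrM -!natr1.
  by ring.
Qed.

(** After multiplication by y D, every term is (-1)^s X times a rational function of p, q and s, and
    a field identity remains. Positivity of p + q keeps y nonzero. *)
Lemma zcoef_three_term p q s : (0 < p + q)%N -> (s <= (minn p q).+1)%N ->
  zcoef F p q s = rec_up p q * zcoef F p.+1 q.+1 s
    + rec_mid p q * zcoef_prev p q s + rec_down p q * zcoef_prev2 p q s.
Proof.
move=> n0 sm; have [e1 e2 e3 e4] := zcoef_fact sm.
have yn : ((p + q).+1 - s != 0)%N by lia.
set D := (_ * _ * _)%:R in e1 e2 e3 e4; set y := ((p + q).+1 - s)%:R in e1 e2 e3 e4.
set X := _`!%:R in e1 e2 e3 e4.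
have D0 : D != 0 by rewrite pnatr_eq0 -lt0n !muln_gt0 !fact_gt0.
have y0 : y != 0 by rewrite pnatr_eq0.
apply: (mulfI y0); apply: (mulIf D0); rewrite e1.
have e4' : rec_down p q * (y * zcoef_prev2 p q s * D)
   = rec_down p q * ((-1) ^+ s * X * (s%:R * (s%:R - 1))).
  have [p0|p0] := posnP p; first by rewrite /rec_down p0 !mul0r.
  have [q0|q0] := posnP q; first by rewrite /rec_down q0 mulr0 !mul0r.
  by rewrite e4.
transitivity (rec_up p q * y * (zcoef F p.+1 q.+1 s * D) + rec_mid p q * y * (zcoef_prev p q s * D)
   + rec_down p q * (y * zcoef_prev2 p q s * D)); last by ring.
rewrite e2 e3 e4' /rec_mid /rec_up /rec_down.
have [sp sq] : (s <= p.+1 /\ s <= q.+1)%N by lia.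
have sn : (s <= (p + q).+1)%N by lia.
rewrite /y !natrB // -!natr1 natrD.
have n1 : p%:R + q%:R != 0 :> F by rewrite -natrD pnatr_eq0; lia.
have n2 : p%:R + q%:R + 1 != 0 :> F by rewrite -natrD natr1 pnatr_eq0.
have n3 : p%:R + q%:R + 1 + 1 != 0 :> F by rewrite -natrD !natr1 pnatr_eq0.
move: ((-1) ^+ s) (X) (p%:R : F) (q%:R : F) (s%:R : F) n1 n2 n3 => g X' a b t n1 n2 n3.
by field; rewrite n1 n2 n3.
Qed.

End ThreeTermCoefficients.

(** * Normalised recurrence and telescoping *)

Section ChristoffelDarboux.
Variable R : realType.
Notation C := R[i].
Implicit Types (p q n : nat) (r phi rho theta : R).

Definition dpoly p q r phi : C :=
  \sum_(s < (minn p q).+1) (zcoef R p q s)%:C * zmon (p - s) (q - s) r phi.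

Lemma sqrC_zmon r phi : (r ^+ 2)%:C = zmon 1 1 r phi.
Proof. by rewrite -(zcM_conj r phi) /zmon !expr1. Qed.

Lemma dpoly_three_term p q r phi :
  (r ^+ 2)%:C * dpoly p q r phi = (rec_up R p q)%:C * dpoly p.+1 q.+1 r phi
    + (rec_mid R p q)%:C * dpoly p q r phi + (rec_down R p q)%:C * dpoly p.-1 q.-1 r phi.
Proof.
(* For p = q = 0 the recurrence is checked by hand: D_{1,1} = 2 |z|^2 - 1. *)
have [n0|n0] := posnP (p + q).
  have [-> ->] : p = 0%N /\ q = 0%N by lia.
  have d0 : dpoly 0 0 r phi = 1.
    by rewrite /dpoly minnn big_ord_recl big_ord0 addr0 /zcoef /zbin /zmon bin0 !expr0 !mulr1.
  have d1 : dpoly 1 1 r phi = 2 * (r ^+ 2)%:C - 1.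
    rewrite (sqrC_zmon r phi) /dpoly minnn !big_ord_recl big_ord0 addr0 /zcoef /zbin /= !subn0.
    rewrite (_ : bump 0 0 = 1%N) // (_ : (1 + 1 - 1)%N = 1%N) // bin0 bin1 binn subnn.
    by rewrite expr0 expr1 mul1r mul1n muln1 mulr1 /zmon !expr0 mulr1 rmorphN1 mulr1 rmorph_nat.
  have ru : rec_up R 0 0 = 2^-1 by rewrite /rec_up mulr1 mulr1 mul1r.
  have rd : rec_down R 0 0 = 0 by rewrite /rec_down mulr0n !mul0r.
  rewrite d0 d1 /rec_mid ru rd mul0r addr0 !mulr1 subr0.
  have -> : 1 - 2^-1 = 2^-1 :> R by field.
  by rewrite fmorphV rmorph_nat; field.
pose m := minn p q.
pose mon s := zmon (p.+1 - s) (q.+1 - s) r phi.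
have up : dpoly p.+1 q.+1 r phi = \sum_(s < m.+2) (zcoef R p.+1 q.+1 s)%:C * mon s.
  by rewrite /dpoly minnSS.
have left : (r ^+ 2)%:C * dpoly p q r phi = \sum_(s < m.+2) (zcoef R p q s)%:C * mon s.
  rewrite big_ord_recr /= {2}/zcoef zbin_small // mulr0 mul0r addr0 mulr_sumr.
  apply: eq_bigr => s _; have := ltn_ord s; rewrite ltnS leq_min => /andP[sp sq].
  by rewrite mulrCA (sqrC_zmon r phi) /mon !subSn // zmonM !add1n.
have prev : dpoly p q r phi = \sum_(s < m.+2) (zcoef_prev R p q s)%:C * mon s.
  by rewrite [RHS]big_ord_recl /= mul0r add0r.
(* If p or q is 0, the predecessors are meaningless but [rec_down] vanishes; hence the equation
   carries this factor. *)
have prev2 : (rec_down R p q)%:C * dpoly p.-1 q.-1 r phi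
    = (rec_down R p q)%:C * \sum_(s < m.+2) (zcoef_prev2 R p q s)%:C * mon s.
  have [p0|p0] := posnP p; first by rewrite /rec_down p0 !mul0r.
  have [q0|q0] := posnP q; first by rewrite /rec_down q0 mulr0 !mul0r.
  congr (_ * _); rewrite [RHS]big_ord_recl [X in _ = _ + X]big_ord_recl /= !mul0r !add0r /dpoly.
  have -> : (minn p.-1 q.-1).+1 = m by rewrite /m; lia.
  apply: eq_bigr => s _; congr (_ * zmon _ _ _ _); rewrite /bump /=; lia.
rewrite left up prev prev2 !mulr_sumr -!big_split; apply: eq_bigr => s _ /=.
rewrite (@zcoef_three_term R p q s n0); last by have := ltn_ord s.
move: (zcoef R p.+1 q.+1 s) (zcoef_prev R p q s) (zcoef_prev2 R p q s) => x y z.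
move: (rec_up R p q) (rec_mid R p q) (rec_down R p q) => a b d.
by rewrite !rmorphD !rmorphM /=; ring.
Qed.


(** With c = pi and {x, y} = {n + 1, n + 3}, the square root in [bcoef] exchanges the normalising
    constants of degrees n and n + 2. *)
Lemma sqrt_ratio (x y c : R) : 0 < x -> 0 < y -> 0 < c ->
  Num.sqrt (y / c) * (1 / Num.sqrt (x * y)) = Num.sqrt (x / c) / x.
Proof.
move=> x0 y0 c0; rewrite !sqrtrM ?sqrtrV ?ltW // mul1r invfM.
have sx : Num.sqrt x != 0 by rewrite gt_eqF // sqrtr_gt0.
have sy : Num.sqrt y != 0 by rewrite gt_eqF // sqrtr_gt0.
rewrite -[X in _ = _ / X](sqr_sqrtr (ltW x0)); move: (Num.sqrt c)^-1 => d.
by field; rewrite sx sy.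
Qed.

Lemma bcoefE p q : bcoef (p + q) (p%:Z - q%:Z)
  = p.+1%:R * q.+1%:R / (p + q).+2%:R * (1 / Num.sqrt ((p + q).+1%:R * (p + q).+3%:R)) :> R.
Proof.
rewrite /bcoef; congr (_ * _).
have n0 : (p + q).+2%:R != 0 :> R by rewrite pnatr_eq0.
have -> : (p + q).+2%:R ^+ 2 - (p%:Z - q%:Z)%:~R ^+ 2 = 4 * (p.+1%:R * q.+1%:R) :> R.
  by rewrite rmorphB /= -!natr1 natrD; ring.
by rewrite -mulf_div mulfV ?mul1r // pnatr_eq0.
Qed.

Lemma znorm_up p q : znorm R p q * rec_up R p q
  = bcoef (p + q) (p%:Z - q%:Z) * znorm R p.+1 q.+1.
Proof.
have e := @sqrt_ratio (p + q).+1%:R (p + q).+3%:R (pi : R) (ltr0Sn _ _) (ltr0Sn _ _) (pi_gt0 R).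
rewrite bcoefE /znorm addSn addnS -[RHS]mulrA [X in _ = _ * X]mulrC e /rec_up.
rewrite invfM; ring.
Qed.

Lemma znorm_down p q : znorm R p.+1 q.+1 * rec_down R p.+1 q.+1
  = bcoef (p + q) (p%:Z - q%:Z) * znorm R p q.
Proof.
have := @sqrt_ratio (p + q).+3%:R (p + q).+1%:R (pi : R) (ltr0Sn _ _) (ltr0Sn _ _) (pi_gt0 R).
rewrite [_ * (p + q).+1%:R]mulrC => e.
rewrite bcoefE /znorm addSn addnS -[RHS]mulrA [X in _ = _ * X]mulrC e /rec_down.
rewrite addSn addnS invfM; ring.
Qed.

Lemma zd_dpoly p q r phi : zd p q r phi = (znorm R p q)%:C * dpoly p q r phi.
Proof. exact: zd_disk. Qed.

(** Normalisation makes the recurrence symmetric: the same [bcoef] couples (p, q) to (p + 1, q + 1)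
    in both directions. This symmetry is what lets the sums telescope. *)
Lemma zd_three_term p q r phi : (r ^+ 2)%:C * zd p q r phi
  = (bcoef (p + q) (p%:Z - q%:Z))%:C * zd p.+1 q.+1 r phi
    + (rec_mid R p q)%:C * zd p q r phi
    + (if (0 < p)%N && (0 < q)%N then
         (bcoef (p.-1 + q.-1) (p.-1%:Z - q.-1%:Z))%:C * zd p.-1 q.-1 r phi else 0).
Proof.
have up : (bcoef (p + q) (p%:Z - q%:Z))%:C * zd p.+1 q.+1 r phi
    = (znorm R p q)%:C * ((rec_up R p q)%:C * dpoly p.+1 q.+1 r phi).
  by rewrite zd_dpoly !mulrA -!(rmorphM (real_complex R)) /= znorm_up.
have down : (if (0 < p)%N && (0 < q)%N then
         (bcoef (p.-1 + q.-1) (p.-1%:Z - q.-1%:Z))%:C * zd p.-1 q.-1 r phi else 0)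
    = (znorm R p q)%:C * ((rec_down R p q)%:C * dpoly p.-1 q.-1 r phi).
  case: p {up} => [|p] /=; first by rewrite /rec_down !mul0r mulr0.
  case: q => [|q] /=; first by rewrite /rec_down mulr0 !mul0r mulr0.
  by rewrite zd_dpoly !mulrA -!(rmorphM (real_complex R)) /= znorm_down.
rewrite up down !zd_dpoly mulrCA dpoly_three_term.
by ring.
Qed.

Definition cdpq p q rho theta r phi : C :=
  cd_term (p + q) (p%:Z - q%:Z) rho theta r phi.

Lemma cdpqE p q rho theta r phi : cdpq p q rho theta r phi =
  (bcoef (p + q) (p%:Z - q%:Z))%:C *
  (zd p.+1 q.+1 r phi * Num.conj (zd p q rho theta)
   - zd p q r phi * Num.conj (zd p.+1 q.+1 rho theta)).
Proof.
rewrite /cdpq /cd_term /zd addSn addnS.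
by have -> : p.+1%:Z - q.+1%:Z = p%:Z - q%:Z by lia.
Qed.

(** Use the recurrence at both points and subtract. The middle terms cancel because [rec_mid] is
    real, and the remaining terms group into two consecutive [cdpq]. *)
Lemma cd_step p q rho theta r phi :
  (r ^+ 2 - rho ^+ 2)%:C * (Num.conj (zd p q rho theta) * zd p q r phi)
  = cdpq p q rho theta r phi
    - (if (0 < p)%N && (0 < q)%N then cdpq p.-1 q.-1 rho theta r phi else 0).
Proof.
have := zd_three_term p q r phi; have /(congr1 Num.conj) := zd_three_term p q rho theta.
rewrite !cdpqE; case: ifP => [/andP[p0 q0]|_].
  rewrite !prednK //.
  move: (zd p q r phi) (zd p.+1 q.+1 r phi) (zd p.-1 q.-1 r phi) => Z Zu Zd.
  move: (zd p q rho theta) (zd p.+1 q.+1 rho theta) (zd p.-1 q.-1 rho theta) => W Wu Wd.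
  move: (bcoef _ _) (bcoef _ _) (rec_mid R p q) (r ^+ 2) (rho ^+ 2) => u d m x y.
  rewrite 2!rmorphD !rmorphM /= !conj_realC rmorphB /= => eW eZ.
  by rewrite mulrBl mulrCA eZ mulrA eW; ring.
move: (zd p q r phi) (zd p.+1 q.+1 r phi) => Z Zu.
move: (zd p q rho theta) (zd p.+1 q.+1 rho theta) => W Wu.
move: (bcoef _ _) (rec_mid R p q) (r ^+ 2) (rho ^+ 2) => u m x y.
rewrite 2!rmorphD !rmorphM /= !conj_realC rmorph0 rmorphB /= => eW eZ.
by rewrite mulrBl mulrCA eZ mulrA eW; ring.
Qed.

Definition cd_sum n rho theta r phi : C :=
  \sum_(t < n.+1) cd_term n (az n t) rho theta r phi.

Lemma cd_sumE n rho theta r phi :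
  cd_sum n rho theta r phi = \sum_(t < n.+1) cdpq t (n - t) rho theta r phi.
Proof.
apply: eq_bigr => t _; have tn : (t <= n)%N by rewrite -ltnS.
rewrite /cdpq subnKC //; congr cd_term; rewrite /az; lia.
Qed.

Lemma cd_degree n rho theta r phi :
  (r ^+ 2 - rho ^+ 2)%:C *
    (\sum_(t < n.+1) Num.conj (zernike n (az n t) rho theta) * zernike n (az n t) r phi)
  = cd_sum n rho theta r phi - (if n is n'.+2 then cd_sum n' rho theta r phi else 0).
Proof.
rewrite cd_sumE mulr_sumr.
transitivity (\sum_(t < n.+1) (cdpq t (n - t) rho theta r phi -
   (if (0 < t)%N && (0 < n - t)%N then cdpq t.-1 (n - t).-1 rho theta r phi else 0))).
  apply: eq_bigr => t _; have tn : (t <= n)%N by rewrite -ltnS.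
  by rewrite zernike_az // cd_step.
rewrite sumrB; congr (_ - _).
(* The modes t = 0 and t = n have no predecessor; the others shift down to all modes of degree n -
   2. *)
rewrite big_ord_recl /= add0r.
case: n => [|n]; first by rewrite big_ord0.
rewrite big_ord_recr /= /bump /= subnn /= addr0.
case: n => [|n]; first by rewrite big_ord0.
rewrite cd_sumE; apply: eq_bigr => t _ /=; rewrite /bump /=.
have tn := ltn_ord t; rewrite ifT; last by lia.
by congr cdpq; lia.
Qed.

(** Telescoping proceeds by steps of two in the degree, so the two top degrees N and N - 1
    survive. *)
Lemma christoffel_darboux N rho theta r phi :
  (r ^+ 2 - rho ^+ 2)%:C * kernel_poly N rho theta r phi
  = cd_sum N rho theta r phi + (if N is N'.+1 then cd_sum N' rho theta r phi else 0).
Proof.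
elim: N => [|N IH].
  by rewrite /kernel_poly big_ord_recl big_ord0 addr0 cd_degree subr0 addr0.
rewrite /kernel_poly big_ord_recr mulrDr /= -/(kernel_poly N rho theta r phi) IH cd_degree.
by case: N {IH} => [|N]; ring.
Qed.

End ChristoffelDarboux.

(** * The scaling functions *)

Section ScalingFunctions.
Variables (R : realType) (N : nat) (rho theta : 'I_(dimV N) -> R).
Hypothesis hP : regular_points rho theta.
Notation C := R[i].
Notation Z := (@zernike1 R N).
Notation A := (zernike_mx rho theta).

Lemma regular_polar j : polar (rho j) (theta j).
Proof. by case: hP. Qed.

Lemma scaling_in_V j : V N (scaling rho theta j).
Proof. by rewrite /scaling kernel_zcomb; exact: zcomb_in_V. Qed.

(** The value is the sum of the |Z_s(P_j)|^2. Were it zero, every element of V_N would vanish at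
    P_j, including the constant 1. *)
Lemma scaling_diag_gt0 j : 0 < scaling rho theta j (rho j) (theta j).
Proof.
rewrite /scaling kernel_polyE lt0r sumr_ge0 ?andbT; last first.
  by move=> s _; rewrite mulrC mul_conjC_ge0.
apply/eqP => /psumr_eq0P w0.
have Z0 (s : 'I_(dimV N)) : Z s (rho j) (theta j) = 0.
  have /eqP := w0 (fun s _ => ltac:(by rewrite mulrC mul_conjC_ge0)) s isT.
  by rewrite mulf_eq0 conjC_eq0 orbb => /eqP.
have V1 : V N (@xymon R 0 0) by rewrite VE; exact: bispan_gen.
have [a aE] := V_zcomb V1.
have := aE _ _ (regular_polar j); rewrite /zcomb big1 => [|s _]; last by rewrite Z0 mulr0.
by move/eqP; rewrite /xymon !expr0 mulr1 oner_eq0.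
Qed.

Lemma norm2_zcomb_le (f g : R -> R -> C) (a b : 'I_(dimV N) -> C) :
  eq_disk f (zcomb a) -> eq_disk g (zcomb b) ->
  \sum_s a s * Num.conj (a s) <= \sum_s b s * Num.conj (b s) -> norm2 f <= norm2 g.
Proof.
move=> fa gb; rewrite -!inner_zcomb /norm2.
rewrite (eq_inner (zpoly_zcomb a) (zpoly_zcomb a) fa fa).
rewrite (eq_inner (zpoly_zcomb b) (zpoly_zcomb b) gb gb) lecE => /andP[_ h].
exact: ler_wsqrtr.
Qed.

Lemma scaling_localized j : is_minimum
  [set norm2 p | p in [set p | V N p /\ p (rho j) (theta j) = 1]]
  (norm2 (fun r phi => scaling rho theta j r phi / scaling rho theta j (rho j) (theta j))).
Proof.
have := scaling_diag_gt0 j; set K := scaling rho theta j (rho j) (theta j).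
have Kdef : scaling rho theta j (rho j) (theta j) = K by [].
move: K Kdef => K Kdef K0; have K1 : K != 0 by rewrite gt_eqF.
have Kc : Num.conj K = K by apply/CrealP/gtr0_real.
pose w (s : 'I_(dimV N)) := Z s (rho j) (theta j).
have KE : \sum_s Num.conj (w s) * w s = K by rewrite -Kdef /scaling kernel_polyE.
pose b (s : 'I_(dimV N)) := Num.conj (w s) / K.
set u := (fun r phi => scaling rho theta j r phi / K).
have ub : eq_disk u (zcomb b).
  move=> r phi _; rewrite /u /scaling kernel_polyE mulr_suml.
  by apply: eq_bigr => s _; rewrite mulrAC.
have bb : \sum_s b s * Num.conj (b s) = K^-1.
  transitivity (\sum_s (Num.conj (w s) * w s) * K^-2).
    apply: eq_bigr => s _; rewrite /b; move: (w s) => x.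
    by rewrite rmorphM /= conjCK fmorphV /= Kc mulrACA expr2 invfM.
  by rewrite -mulr_suml KE expr2 invfM mulVKf.
split.
  exists u => //; split; last by rewrite /u Kdef divff.
  by have [We _ _ _] := V_subspace R N; apply: We ub _; exact: zcomb_in_V.
move=> _ [p [Vp p1] <-]; have [a pa] := V_zcomb Vp.
have aw : \sum_s a s * w s = 1 by rewrite -p1 pa //; exact: regular_polar.
apply: (norm2_zcomb_le ub pa); rewrite bb -subr_ge0.
(* Completing the square: since p(P_j) = 1, the inner product of the coordinate vectors [a] and [b]
   is 1 / K, which is also the squared length of [b]. *)
have -> : \sum_s a s * Num.conj (a s) - K^-1
    = \sum_s (a s - b s) * Num.conj (a s - b s).
  transitivity (\sum_s (a s * Num.conj (a s) - (a s * w s) / K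
     - Num.conj (a s * w s) / K + b s * Num.conj (b s))); last first.
    apply: eq_bigr => s _; rewrite /b; move: (a s) (w s) => x y.
    by rewrite rmorphB !rmorphM /= conjCK fmorphV /= Kc; ring.
  rewrite big_split /= !sumrB -!mulr_suml -rmorph_sum aw rmorph1 bb; ring.
by apply: sumr_ge0 => s _; exact: mul_conjC_ge0.
Qed.

(** In Zernike coordinates the scaling functions are the rows of the entrywise conjugate of the
    collocation matrix, which is invertible. *)
Lemma scaling_basis : is_basis (V N) (scaling rho theta).
Proof.
pose B := map_mx Num.conj A.
have uB : B \in unitmx by rewrite map_unitmx zernike_mx_unit.
have comb (c : 'I_(dimV N) -> C) r phi : \sum_j c j * scaling rho theta j r phi
    = zcomb (fun s => \sum_j c j * B j s) r phi.
  rewrite /zcomb; under [RHS]eq_bigr do rewrite mulr_suml.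
  rewrite exchange_big; apply: eq_bigr => j _ /=.
  rewrite /scaling kernel_polyE mulr_sumr; apply: eq_bigr => s _.
  by rewrite !mxE mulrA.
split.
- exact: scaling_in_V.
- move=> c c0 j.
  have z0 : eq_disk (zcomb (fun s => \sum_j c j * B j s)) (fun _ _ => 0).
    by move=> r phi p; rewrite -comb c0.
  have cB : (\row_j c j) *m B = 0.
    apply/rowP => s; rewrite !mxE -[RHS](zcomb_eq0 z0 s).
    by apply: eq_bigr => i _; rewrite mxE.
  have : \row_j c j = 0 by rewrite -[LHS](mulmxK uB) cB mul0mx.
  by move/rowP/(_ j); rewrite !mxE.
- move=> g /V_zcomb[a ga]; pose c := (\row_s a s) *m invmx B.
  exists (fun j => c 0 j) => r phi p; rewrite comb ga //; apply: eq_bigr => s _.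
  congr (_ * _); have : c *m B = \row_s a s by rewrite mulmxKV.
  by move/rowP/(_ s); rewrite !mxE => <-.
Qed.

Lemma det_zernike_mx_neq0 : \det A != 0.
Proof. by rewrite -unitfE -unitmxE zernike_mx_unit. Qed.

Lemma lagrange_poly_in_V k : V N (lagrange_poly rho theta k).
Proof.
have [We _ _ _] := V_subspace R N.
apply: We (zcomb_in_V (fun s => cofactor A k s / \det A)) => r phi _.
(* Expanding along the replaced row leaves the cofactors of the collocation matrix as constant
   coefficients. *)
rewrite /lagrange_poly (expand_det_row _ k) mulr_suml; apply: eq_bigr => s _.
rewrite mxE eqxx [X in _ * X / _](_ : _ = cofactor A k s); first by rewrite -mulrA mulrC.
congr (_ * \det _); apply/matrixP => i l; rewrite !mxE.
by rewrite eq_sym (negbTE (neq_lift _ _)).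
Qed.

Lemma lagrange_fundamental : is_fundamental rho theta (lagrange_poly rho theta).
Proof.
move=> k; split=> [|j]; first exact: lagrange_poly_in_V.
rewrite /lagrange_poly; have [<-|kj] := eqVneq k j.
  rewrite [X in \det X](_ : _ = A) ?divff ?det_zernike_mx_neq0 //.
  by apply/matrixP => i l; rewrite !mxE; case: eqP => // ->.
rewrite (determinant_alternate kj) ?mul0r // => l.
by rewrite !mxE eqxx eq_sym (negbTE kj).
Qed.

Lemma scaling_dual j k :
  inner (scaling rho theta j) (lagrange_poly rho theta k) = (j == k)%:R.
Proof.
rewrite inner_kernel; [|exact: lagrange_poly_in_V|exact: regular_polar].
by rewrite (lagrange_fundamental k).2 rmorph_nat eq_sym.
Qed.

(** The inner product is the conjugate of the value at P_j, where the factor h - v vanishes. *)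
Lemma scaling_orthogonal j (h q : R -> R -> C) (v : C) :
  V N (fun r phi => q r phi * (h r phi - v)) -> h (rho j) (theta j) = v ->
  inner (scaling rho theta j) (fun r phi => q r phi * (h r phi - v)) = 0.
Proof.
move=> Vq hv; rewrite inner_kernel //; last exact: regular_polar.
by rewrite hv subrr mulr0 rmorph0.
Qed.

End ScalingFunctions.

Lemma V_mul_shift (R : realType) N (h q : R -> R -> R[i]) (v : R[i]) :
  V N q -> V N.+1 (fun r phi => h r phi * q r phi) ->
  V N.+1 (fun r phi => q r phi * (h r phi - v)).
Proof.
move=> Vq Vh; have [We _ WD WZ] := V_subspace R N.+1.
have Vq' : V N.+1 q by move: Vq; rewrite !VE; exact: bispan_mono.
apply: We (WD _ _ Vh (WZ (- v) _ Vq')) => r phi _; ring.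
Qed.

Theorem theorem2p7 (R : realType) (N : nat) (hN : (1 <= N)%N)
    (rho theta : 'I_(dimV N) -> R) (hP : regular_points rho theta) :
  (* (i) *)
  (forall i j, inner (scaling rho theta i) (scaling rho theta j)
               = scaling rho theta i (rho j) (theta j)) /\
  (* (ii) *)
  (forall j,
     is_minimum
       [set norm2 p | p in [set p | V N p /\ p (rho j) (theta j) = 1]]
       (norm2 (fun r phi => scaling rho theta j r phi
                            / scaling rho theta j (rho j) (theta j)))) /\
  (* (iii) *)
  is_basis (V N) (scaling rho theta) /\
  (* (iv) *)
  (is_fundamental rho theta (lagrange_poly rho theta) /\
   forall j k, inner (scaling rho theta j) (lagrange_poly rho theta k)
               = (j == k)%:R) /\
  (* (v) *)
  (forall j q, V N.-1 q ->
     inner (scaling rho theta j)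
       (fun r phi => q r phi * (r * cos phi - rho j * cos (theta j))%:C) = 0 /\
     inner (scaling rho theta j)
       (fun r phi => q r phi * (r * sin phi - rho j * sin (theta j))%:C) = 0) /\
  (* (vi) *)
  (forall j r phi, polar r phi -> r != rho j ->
     scaling rho theta j r phi =
       \sum_(t < N.+1)
         cd_term N (az N t) (rho j) (theta j) r phi
         / (r ^+ 2 - rho j ^+ 2)%:C
       + \sum_(t < N.-1.+1)
         cd_term N.-1 (az N.-1 t) (rho j) (theta j) r phi
         / (r ^+ 2 - rho j ^+ 2)%:C).
Proof.
split.
  move=> i j; rewrite [LHS](kernel_reproducing (scaling_in_V rho theta i)) //.
  exact: regular_polar.
split; first exact: scaling_localized.
split; first exact: scaling_basis.
split; first by split; [exact: lagrange_fundamental|exact: scaling_dual].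
split.
  move=> j q Vq; split.
  - under eq_fun do under eq_fun do rewrite (rmorphB (real_complex R)) /=.
    apply: (scaling_orthogonal hP (h := fun r phi => (r * cos phi)%:C)) => //.
    by rewrite -(prednK hN); apply: V_mul_shift => //; exact: V_mulx.
  - under eq_fun do under eq_fun do rewrite (rmorphB (real_complex R)) /=.
    apply: (scaling_orthogonal hP (h := fun r phi => (r * sin phi)%:C)) => //.
    by rewrite -(prednK hN); apply: V_mul_shift => //; exact: V_muly.
move=> j r phi [/andP[r0 _] _] rj.
have /andP[rho0 _] := (regular_polar hP j).1.
(* Both radii are nonnegative, so distinct radii have distinct squares. *)
have d0 : (r ^+ 2 - rho j ^+ 2)%:C != 0.
  rewrite (_ : 0 = 0%:C) // (inj_eq (@complexI R)) subr_eq0.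
  by rewrite eqrXn2.
have pred M : (1 <= M)%N ->
    (if M is M'.+1 then cd_sum M' (rho j) (theta j) r phi else 0)
    = cd_sum M.-1 (rho j) (theta j) r phi by case: M.
apply: (mulfI d0); rewrite [LHS]christoffel_darboux pred //.
by rewrite -!mulr_suml -mulrDl mulrCA mulfV // mulr1.
Qed.
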